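(* Let $\|\cdot\|$ be a strictly convex norm on $\mathbb R^2$ that is $C^1$ on $\mathbb R^2\setminus\{0\}$. There exists a constant $C_0>0$ depending only on $\mathsf B$ such that \[C_0^{-1}\mathrm c^{1D}(z^+,z^-)\le\mathrm c^{\mathrm{ENT}}(z^+,z^-)\le C_0\,\mathrm c^{1D}(z^+,z^-)\] for all distinct $z^+,z^-\in\partial\mathsf B$.
   Context: $\mathsf B=\{\|z\|<1\}$, normalized so $\partial\mathsf B$ has length $2\pi$; $\gamma:\mathbb R/2\pi\mathbb Z\to\partial\mathsf B$ is the counterclockwise arc-length parametrization; $\mathbb R^2\cong\mathbb C$ and $i$ is rotation by $\pi/2$. For distinct $z^\pm\in\partial\mathsf B$ set $\nu=i\frac{z^+-z^-}{|z^+-z^-|}$ and $a=z^+\cdot\nu=z^-\cdot\nu$. Define \[\mathrm c^{1D}(z^+,z^-)=2\Big|\int_{z^-\cdot i\nu}^{z^+\cdot i\nu}\big(1-\|a\nu+s\,i\nu\|^2\big)\,ds\Big|,\] \[\mathrm c^{\mathrm{ENT}}(z^+,z^-)=\sup_{\lambda\in\Lambda_*}\int_{\theta^-}^{\theta^+}\lambda(t)\,\gamma'(t)\cdot\nu\,dt\quad\text{where }z^\pm=\gamma(\theta^\pm),\] with $\Lambda_*=\{\lambda\in C^1(\mathbb R/2\pi\mathbb Z):\int_{\mathbb R/2\pi\mathbb Z}\lambda\gamma'\,dt=0,\ \|\lambda'\|_\infty\le1\}$ (the integral does not depend on the choice of $\theta^\pm$ modulo $2\pi$). *)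

(* Defs.v *)
From Stdlib Require Import Reals.
From Coquelicot Require Export Coquelicot.
Open Scope R_scope.

Definition vec := (R * R)%type.
Definition vadd (u v : vec) : vec := (fst u + fst v, snd u + snd v).
Definition vsub (u v : vec) : vec := (fst u - fst v, snd u - snd v).
Definition vscal (t : R) (u : vec) : vec := (t * fst u, t * snd u).
Definition dot (u v : vec) : R := fst u * fst v + snd u * snd v.
Definition rot (u : vec) : vec := (- snd u, fst u).
Definition enorm (u : vec) : R := sqrt (dot u u).
Definition det2 (u v : vec) : R := fst u * snd v - snd u * fst v.

Definition is_norm (N : vec -> R) : Prop :=
  (forall x, N x = 0 -> x = (0, 0)) /\
  (forall t x, N (vscal t x) = Rabs t * N x) /\
  (forall x y, N (vadd x y) <= N x + N y).

Definition strictly_convex (N : vec -> R) : Prop :=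
  forall x y, N x = 1 -> N y = 1 -> x <> y -> N (vscal (/ 2) (vadd x y)) < 1.

Definition C1_away_from_0 (N : vec -> R) : Prop :=
  exists g : vec -> vec, forall x, x <> (0, 0) ->
    filterdiff N (locally x) (fun h => dot (g x) h) /\ continuous g x.

(* gam : R -> dB is the counterclockwise (Euclidean) arc-length parametrization
   of dB = {N = 1}, 2pi-periodic and injective on one period (this encodes the
   normalization "length of dB = 2pi"); dgam is its derivative gamma'. *)
Definition arclength_param (N : vec -> R) (gam dgam : R -> vec) : Prop :=
  (forall t, is_derive gam t (dgam t)) /\
  (forall t, continuous dgam t) /\
  (forall t, enorm (dgam t) = 1) /\
  (forall t, gam (t + 2 * PI) = gam t) /\
  (forall t, N (gam t) = 1) /\
  (forall z, N z = 1 -> exists t, gam t = z) /\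
  (forall s t, 0 <= s < 2 * PI -> 0 <= t < 2 * PI -> gam s = gam t -> s = t) /\
  (forall t, 0 <= det2 (gam t) (dgam t)).

Definition in_Lambda_star (dgam : R -> vec) (lam dlam : R -> R) : Prop :=
  (forall t, lam (t + 2 * PI) = lam t) /\
  (forall t, is_derive lam t (dlam t)) /\
  (forall t, continuous dlam t) /\
  (forall t, Rabs (dlam t) <= 1) /\
  RInt (fun t => lam t * fst (dgam t)) 0 (2 * PI) = 0 /\
  RInt (fun t => lam t * snd (dgam t)) 0 (2 * PI) = 0.

Definition nu (zp zm : vec) : vec := vscal (/ enorm (vsub zp zm)) (rot (vsub zp zm)).

Definition c1D (N : vec -> R) (zp zm : vec) : R :=
  let n := nu zp zm in
  let a := dot zp n in
  2 * Rabs (RInt (fun s => 1 - (N (vadd (vscal a n) (vscal s (rot n)))) ^ 2)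
                 (dot zm (rot n)) (dot zp (rot n))).

Definition cENT (gam dgam : R -> vec) (zp zm : vec) : Rbar :=
  Lub_Rbar (fun v => exists (lam dlam : R -> R) (thp thm : R),
    in_Lambda_star dgam lam dlam /\ gam thp = zp /\ gam thm = zm /\
    v = RInt (fun t => lam t * dot (dgam t) (nu zp zm)) thm thp).

(* Main.v *)
Require Import Defs.
From Stdlib Require Import Reals Lra Lia Psatz List.
From Coquelicot Require Import Coquelicot.
Open Scope R_scope.

(* Exchanging [zp] and [zm] changes neither cost, so one may assume [a <= 0]: the
   counterclockwise arc from [zm] to [zp] and the origin are then on opposite sides
   of the chord line.  Let [L] be the length of the chord, [h] the height of
   the arc over the chord and [H] its maximum.  Both costs are comparable to
   [H * L], with constants depending only on an inner radius [r] and an outer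
   radius [M] of the ball and on the moments below.

   On the chord [1 - N] is at most [H / r] (supporting functional at the apex)
   and, by concavity, at least [(H / M) u (1 - u)], since the segment from the
   origin to the apex crosses the chord.  Integrating by parts, the entropy
   integral is [int lam' h] over the arc, hence at most [H] times the length of
   the arc, and the arc is at most a constant times [L].  For the lower bound one
   takes [lam'] proportional to the positive part of [h], corrected far from the
   arc so that it is orthogonal to [1] and to the coordinates of [gam]; there are
   finitely many corrections to choose from, by a finite cover of the circle and
   the linear independence of these three functions on every arc, which is where
   strict convexity enters.  The remaining integral of [h ^ 2] is bounded below
   because the area under the arc is at least that of an inscribed triangle. *)

(** * Continuity, integrals and periodicity *)

Lemma cont_plus (f g : R -> R) t :
  continuous f t -> continuous g t -> continuous (fun s => f s + g s) t.
Proof. exact (continuous_plus f g t). Qed.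

Lemma cont_opp (f : R -> R) t : continuous f t -> continuous (fun s => - f s) t.
Proof. exact (continuous_opp f t). Qed.

Lemma cont_minus (f g : R -> R) t :
  continuous f t -> continuous g t -> continuous (fun s => f s - g s) t.
Proof. exact (continuous_minus f g t). Qed.

Lemma cont_mult (f g : R -> R) t :
  continuous f t -> continuous g t -> continuous (fun s => f s * g s) t.
Proof. exact (continuous_mult f g t). Qed.

Lemma cont_max0 (f : R -> R) t : continuous f t -> continuous (fun s => Rmax 0 (f s)) t.
Proof.
  intros Hf.
  apply continuous_ext with (fun s => / 2 * (f s + Rabs (f s))).
  - intros s; unfold Rmax; destruct (Rle_dec 0 (f s)) as [h|h];
      [rewrite Rabs_pos_eq by lra | rewrite Rabs_left by lra]; lra.
  - apply cont_mult; [apply continuous_const|].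
    apply cont_plus; [exact Hf|].
    apply (continuous_comp f Rabs); [exact Hf|].
    apply continuity_pt_filterlim, Rcontinuity_abs.
Qed.

(** Structural proof of continuity. The last four cases pass between eta-expanded and eta-contracted
    forms, so that the other cases or a hypothesis match. *)
Ltac cont :=
  repeat match goal with
    | H : forall _, continuous ?f _ |- continuous ?f _ => exact (H _)
    | |- continuous (fun s => s) _ => apply continuous_id
    | |- continuous (fun _ => ?c) _ => apply continuous_const
    | |- continuous (fun s => _ + _) _ => apply cont_plus
    | |- continuous (fun s => _ - _) _ => apply cont_minus
    | |- continuous (fun s => - _) _ => apply cont_opp
    | |- continuous (fun s => _ * _) _ => apply cont_mult
    | |- continuous (fun s => _ / ?c) _ => apply cont_mult
    | |- continuous (fun s => Rmax 0 _) _ => apply cont_max0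
    | |- continuous (Rplus ?c) ?t => change (continuous (fun s => c + s) t)
    | |- continuous (Rminus ?c) ?t => change (continuous (fun s => c - s) t)
    | |- continuous (Rmult ?c) ?t => change (continuous (fun s => c * s) t)
    | |- continuous (fun s => ?f s) ?t => change (continuous f t)
    end.

Lemma ex_RInt_cont (f : R -> R) a b : (forall t, continuous f t) -> ex_RInt f a b.
Proof. intros H; apply (@ex_RInt_continuous R_CompleteNormedModule); intros; apply H. Qed.

Lemma RInt_antiderivative (F f : R -> R) a b :
  (forall t, is_derive F t (f t)) -> (forall t, continuous f t) ->
  RInt f a b = F b - F a.
Proof.
  intros HF Hf; apply is_RInt_unique.
  apply (is_RInt_derive F f a b); intros; auto.
Qed.

Lemma is_derive_primitive (f : R -> R) c t :
  (forall s, continuous f s) -> is_derive (fun x => RInt f c x) t (f t).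
Proof.
  intros Hf; apply (is_derive_RInt f (fun x => RInt f c x) c t); [|apply Hf].
  apply filter_forall; intros x.
  apply (@RInt_correct R_CompleteNormedModule), ex_RInt_cont, Hf.
Qed.

Lemma RInt_Chasles_cont (f : R -> R) a b c :
  (forall t, continuous f t) -> RInt f a b + RInt f b c = RInt f a c.
Proof. intros Hf; apply (RInt_Chasles f a b c); apply ex_RInt_cont, Hf. Qed.

Lemma RInt_lin2 (f g : R -> R) p q a b :
  (forall t, continuous f t) -> (forall t, continuous g t) ->
  RInt (fun t => p * f t + q * g t) a b = p * RInt f a b + q * RInt g a b.
Proof.
  intros Hf Hg.
  rewrite (RInt_plus (fun t => p * f t) (fun t => q * g t));
    [|apply ex_RInt_cont; intros; cont..].
  change (RInt (fun t => scal p (f t)) a b + RInt (fun t => scal q (g t)) a b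
          = p * RInt f a b + q * RInt g a b).
  rewrite (RInt_scal f), (RInt_scal g) by (apply ex_RInt_cont; assumption).
  reflexivity.
Qed.

Lemma RInt_scal_cont (f : R -> R) p a b :
  (forall t, continuous f t) -> p * RInt f a b = RInt (fun t => p * f t) a b.
Proof. intros Hf; symmetry; apply (RInt_scal f a b p), ex_RInt_cont, Hf. Qed.

Lemma RInt_le_cont (f g : R -> R) a b :
  a <= b -> (forall t, continuous f t) -> (forall t, continuous g t) ->
  (forall t, a < t < b -> f t <= g t) -> RInt f a b <= RInt g a b.
Proof. intros; apply RInt_le; auto; apply ex_RInt_cont; auto. Qed.

Lemma RInt_const_R a b c : RInt (fun _ => c) a b = (b - a) * c.
Proof. apply (RInt_const a b c). Qed.

Lemma periodic_IZR {A : Type} (f : R -> A) T :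
  (forall t, f (t + T) = f t) -> forall k t, f (t + IZR k * T) = f t.
Proof.
  intros Hf k; induction k as [|k IH|k IH] using Z.peano_ind; intros t.
  - f_equal; ring.
  - rewrite succ_IZR, <- (IH t), <- (Hf (t + IZR k * T)); f_equal; ring.
  - rewrite <- (IH t), <- Z.sub_1_r, minus_IZR.
    rewrite <- (Hf (t + (IZR k - 1) * T)); f_equal; ring.
Qed.

Lemma shift_into_period T c t : 0 < T -> exists k, c <= t + IZR k * T < c + T.
Proof.
  (* [up] is a strict ceiling, so [up x - 1] is the floor of [x]; this gives an interval closed on
     the left and open on the right. *)
  intros HT; exists (1 - up ((t - c) / T))%Z.
  destruct (archimed ((t - c) / T)) as [H1 H2].
  rewrite minus_IZR; set (u := IZR (up ((t - c) / T))) in *.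
  set (r := (t - c) / T) in *.
  replace (t + (1 - u) * T) with (c + (r + 1 - u) * T) by (unfold r; field; lra).
  split; nra.
Qed.

Lemma RInt_period_shift (f : R -> R) T t :
  (forall s, continuous f s) -> (forall s, f (s + T) = f s) ->
  RInt f 0 (t + T) = RInt f 0 t + RInt f 0 T.
Proof.
  intros Hf HT.
  rewrite <- (RInt_Chasles_cont f 0 T (t + T)) by exact Hf.
  assert (E := RInt_comp_lin f 1 T 0 t).
  rewrite Rmult_0_r, Rplus_0_l, Rmult_1_l in E.
  rewrite <- E by (apply ex_RInt_cont, Hf).
  rewrite Rplus_comm; f_equal.
  apply RInt_ext; intros x _.
  change (1 * f (1 * x + T) = f x); rewrite 2!Rmult_1_l; apply HT.
Qed.

(** Right difference quotients determine the derivative once it exists. One-sided bounds are all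
    that convexity of [N], or an arc starting at an end point, provides. *)
Lemma derive_le_slope (f : R -> R) x l m e :
  0 < e -> is_derive f x l -> (forall s, 0 < s < e -> f (x + s) <= f x + s * m) -> l <= m.
Proof.
  intros He Hd Hs; apply Rnot_lt_le; intros Hlt.
  apply is_derive_Reals in Hd.
  destruct (Hd (l - m)) as [[d Hd0] Hd1]; [lra|simpl in Hd1].
  set (s := Rmin d e / 2).
  assert (0 < s < e /\ s < d) as [Hs0 Hsd]
    by (unfold s; pose proof (Rmin_l d e); pose proof (Rmin_r d e);
        assert (0 < Rmin d e) by (apply Rmin_glb_lt; lra); lra).
  specialize (Hd1 s ltac:(lra)); rewrite Rabs_pos_eq in Hd1 by lra.
  specialize (Hd1 Hsd); specialize (Hs s Hs0).
  apply Rabs_def2 in Hd1.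
  assert ((f (x + s) - f x) / s <= m); [|lra].
  apply Rmult_le_reg_r with s; [lra|].
  replace ((f (x + s) - f x) / s * s) with (f (x + s) - f x) by (field; lra); lra.
Qed.

Lemma derive_0_const (f : R -> R) t l c : (forall s, f s = c) -> is_derive f t l -> l = 0.
Proof.
  intros Hf Hd; rewrite <- (is_derive_unique _ _ _ Hd).
  rewrite (Derive_ext f (fun _ => c)) by exact Hf; apply Derive_const.
Qed.

Lemma continuous_of_derive (f df : R -> R) :
  (forall t, is_derive f t (df t)) -> forall t, continuous f t.
Proof.
  intros Hf t; apply (ex_derive_continuous f); exists (df t); apply Hf.
Qed.

Lemma MVT_lipschitz (f df : R -> R) K s t :
  (forall u, is_derive f u (df u)) -> (forall u, Rabs (df u) <= K) ->
  Rabs (f t - f s) <= K * Rabs (t - s).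
Proof.
  intros Hf HK.
  destruct (MVT_gen f s t df) as [c [_ ->]].
  - intros; apply Hf.
  - intros; apply continuity_pt_filterlim, (continuous_of_derive f df Hf).
  - rewrite Rabs_mult; apply Rmult_le_compat_r; [apply Rabs_pos|apply HK].
Qed.

Lemma continuous_attains_max (f : R -> R) a b :
  a <= b -> (forall t, continuous f t) ->
  exists m, a <= m <= b /\ forall t, a <= t <= b -> f t <= f m.
Proof.
  intros Hab Hf; destruct (continuity_ab_maj f a b Hab) as [m [H1 H2]].
  - intros; apply continuity_pt_filterlim, Hf.
  - exists m; auto.
Qed.

Lemma derive_0_at_max (f df : R -> R) a b m :
  (forall t, is_derive f t (df t)) -> a < m < b ->
  (forall t, a <= t <= b -> f t <= f m) -> df m = 0.
Proof.
  intros Hf Hm Hmax.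
  assert (H := proj1 (is_derive_Reals _ _ _) (Hf m)).
  assert (E := deriv_maximum f a b m (exist _ (df m) H) (proj1 Hm) (proj2 Hm)).
  apply E; intros; apply Hmax; lra.
Qed.

(** * Integral inequalities *)

Lemma RInt_one_minus_pow2 c : c / 6 = RInt (fun u => c * (u * (1 - u))) 0 1.
Proof.
  rewrite (RInt_antiderivative (fun u => c * (u * u / 2 - u * u * u / 3))).
  - field.
  - intros t; auto_derive; [trivial|field].
  - intros t; cont.
Qed.

(* [(x, h)] is a curve lying on one side of each of its tangents, written with
   [h] pointing to the right of the direction of travel; integrating the tangent
   inequality against the end points of an arc compares the area under the arc
   with an inscribed triangle. *)
Lemma triangle_le_area (x h dx dh : R -> R) a b t1 :
  (forall t, is_derive x t (dx t)) -> (forall t, is_derive h t (dh t)) ->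
  (forall t, continuous dx t) -> (forall t, continuous dh t) ->
  (forall s t, 0 <= (x s - x t) * - dh s + (h s - h t) * dx s) ->
  a <= t1 <= b -> h a = 0 -> h b = 0 ->
  h t1 * (x b - x a) <= 2 * RInt (fun t => h t * dx t) a b.
Proof.
  intros Hx Hh Cdx Cdh Hsup Ht Ha Hb.
  pose proof (continuous_of_derive _ _ Hx) as Cx.
  pose proof (continuous_of_derive _ _ Hh) as Ch.
  (* By the tangent inequality at [t] against [e], the derivative of [(x - x e) * h] is at most
     [2 * h * dx]. Taking [e = a] up to [t1] and [e = b] after it, the boundary terms add up to
     [h t1 * (x b - x a)]. *)
  assert (Hpart : forall c d e, c <= d -> h e = 0 ->
    (x d - x e) * h d - (x c - x e) * h c <= 2 * RInt (fun t => h t * dx t) c d).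
  { intros c d e Hcd He.
    rewrite <- (RInt_antiderivative (fun t => (x t - x e) * h t)
                  (fun t => dx t * h t + (x t - x e) * dh t)).
    - rewrite RInt_scal_cont by (intros; cont).
      apply RInt_le_cont; [exact Hcd|intros; cont..|].
      intros t _; pose proof (Hsup t e); rewrite He in *; lra.
    - intros t; evar_last.
      + apply (is_derive_mult (fun t => x t - x e) h); [|apply Hh|intros; apply Rmult_comm].
        apply (is_derive_minus x (fun _ => x e)); [apply Hx|apply is_derive_const].
      + unfold minus, plus, opp, zero, mult; simpl; ring.
    - intros t; cont. }
  pose proof (Hpart a t1 a (proj1 Ht) Ha) as H1.
  pose proof (Hpart t1 b b (proj2 Ht) Hb) as H2.
  rewrite Ha in H1; rewrite Hb in H2.
  rewrite <- (RInt_Chasles_cont (fun t => h t * dx t) a t1 b) by (intros; cont).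
  lra.
Qed.

(** Integrates a lower bound for the derivative of [q * t - x * h - p * x]; the product [x * h]
    vanishes at both ends. It serves to bound the length of an arc by its chord. *)
Lemma linear_growth_le (x h dx dh : R -> R) p q r a b :
  (forall t, is_derive x t (dx t)) -> (forall t, is_derive h t (dh t)) ->
  (forall t, continuous dx t) -> (forall t, continuous dh t) ->
  a <= b -> h a = 0 -> h b = 0 ->
  (forall t, a < t < b -> r <= q - (dx t * h t + x t * dh t) - p * dx t) ->
  r * (b - a) <= q * (b - a) - p * (x b - x a).
Proof.
  intros Hx Hh Cdx Cdh Hab Ha Hb Hr.
  pose proof (continuous_of_derive _ _ Hx) as Cx.
  pose proof (continuous_of_derive _ _ Hh) as Ch.
  set (F := fun t => q * t - x t * h t - p * x t).
  set (dF := fun t => q - (dx t * h t + x t * dh t) - p * dx t).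
  assert (HF : forall t, is_derive F t (dF t)).
  { intros t; unfold F, dF; evar_last.
    - apply (is_derive_minus (fun t => q * t - x t * h t) (fun t => p * x t)).
      + apply (is_derive_minus (fun t => q * t) (fun t => x t * h t)).
        * apply (is_derive_scal (fun t => t) t q 1), (is_derive_id (K := R_AbsRing)).
        * apply (is_derive_mult x h); [apply Hx|apply Hh|intros; apply Rmult_comm].
      + apply (is_derive_scal x t p); apply Hx.
    - unfold minus, plus, opp, mult; simpl; ring. }
  assert (CF : forall t, continuous dF t) by (intros; unfold dF; cont).
  assert (Hle : (b - a) * r <= RInt dF a b).
  { rewrite <- RInt_const_R; apply RInt_le_cont; [exact Hab|intros; cont|exact CF|exact Hr]. }
  rewrite (RInt_antiderivative F dF a b HF CF) in Hle; unfold F in Hle.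
  rewrite Ha, Hb in Hle; lra.
Qed.

Lemma integration_by_parts (f g df dg : R -> R) a b :
  (forall t, is_derive f t (df t)) -> (forall t, is_derive g t (dg t)) ->
  (forall t, continuous df t) -> (forall t, continuous dg t) ->
  RInt (fun t => f t * dg t) a b + RInt (fun t => df t * g t) a b = f b * g b - f a * g a.
Proof.
  intros Hf Hg Cdf Cdg.
  pose proof (continuous_of_derive _ _ Hf) as Cf.
  pose proof (continuous_of_derive _ _ Hg) as Cg.
  rewrite <- (RInt_antiderivative (fun t => f t * g t) (fun t => f t * dg t + df t * g t)).
  - symmetry; apply (RInt_plus (fun t => f t * dg t) (fun t => df t * g t));
      apply ex_RInt_cont; intros; cont.
  - intros t; evar_last.
    + apply (is_derive_mult f g); [apply Hf|apply Hg|intros; apply Rmult_comm].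
    + unfold plus, mult; simpl; ring.
  - intros; cont.
Qed.

(** If the integral were not positive, the primitive could not grow to the right of [t], and its
    derivative [f t] would be at most 0. *)
Lemma RInt_pos_of_point (f : R -> R) a b t :
  (forall s, continuous f s) -> (forall s, 0 <= f s) -> a < t < b -> 0 < f t ->
  0 < RInt f a b.
Proof.
  intros Cf Hf Ht Hft; apply Rnot_le_lt; intros Hle.
  assert (Hpos : forall c d, c <= d -> 0 <= RInt f c d)
    by (intros; apply RInt_ge_0; auto; apply ex_RInt_cont, Cf).
  assert (f t <= 0); [|lra].
  apply (derive_le_slope (fun s => RInt f a s) t (f t) 0 (b - t)); [lra| |].
  - apply is_derive_primitive, Cf.
  - intros s Hs.
    pose proof (RInt_Chasles_cont f a (t + s) b Cf).
    pose proof (Hpos (t + s) b ltac:(lra)); pose proof (Hpos a t ltac:(lra)); lra.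
Qed.

(** * Moment corrections *)

(** Linear span up to pointwise equality, shaped along the list so that Gram-Schmidt can proceed by
    induction. *)
Fixpoint in_span (l : list (R -> R)) (v : R -> R) : Prop :=
  match l with
  | nil => forall t, v t = 0
  | cons f l' => exists c v', in_span l' v' /\ forall t, v t = c * f t + v' t
  end.

Lemma in_span_add l : forall u v c,
  in_span l u -> in_span l v -> in_span l (fun t => u t + c * v t).
Proof.
  induction l as [|f l IH]; simpl; intros u v c Hu Hv.
  - intros t; rewrite Hu, Hv; ring.
  - destruct Hu as (p & u' & Hu' & Eu), Hv as (q & v' & Hv' & Ev).
    exists (p + c * q), (fun t => u' t + c * v' t); split; [apply IH; assumption|].
    intros t; rewrite Eu, Ev; ring.
Qed.

Lemma in_span_property (P : (R -> R) -> Prop) l :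
  (forall u v, (forall t, u t = v t) -> P u -> P v) ->
  P (fun _ => 0) -> (forall c f v, In f l -> P f -> P v -> P (fun t => c * f t + v t)) ->
  (forall f, In f l -> P f) -> forall v, in_span l v -> P v.
Proof.
  intros Hext H0; induction l as [|f l IH]; simpl; intros Hadd Hl v Hv.
  - apply (Hext (fun _ => 0)); auto.
  - destruct Hv as (c & v' & Hv' & E).
    apply (Hext (fun t => c * f t + v' t)); [intros t; rewrite E; reflexivity|].
    apply Hadd; auto.
Qed.

Lemma in_span_continuous l : (forall f, In f l -> forall t, continuous f t) ->
  forall v, in_span l v -> forall t, continuous v t.
Proof.
  apply (in_span_property (fun v => forall t, continuous v t)).
  - intros u v E Hu t; apply (continuous_ext u v t E (Hu t)).
  - intros t; cont.
  - intros c f v _ Hf Hv t; cont.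
Qed.

Lemma in_span_periodic T l : (forall f, In f l -> forall t, f (t + T) = f t) ->
  forall v, in_span l v -> forall t, v (t + T) = v t.
Proof.
  apply (in_span_property (fun v => forall t, v (t + T) = v t)).
  - intros u v E Hu t; rewrite <- !E; apply Hu.
  - reflexivity.
  - intros c f v _ Hf Hv t; rewrite Hf, Hv; reflexivity.
Qed.

Lemma in_span_orthogonal T l (k : R -> R) : (forall t, continuous k t) ->
  (forall f, In f l -> forall t, continuous f t) ->
  (forall f, In f l -> RInt (fun t => k t * f t) 0 T = 0) ->
  forall v, in_span l v -> RInt (fun t => k t * v t) 0 T = 0.
Proof.
  intros Ck; induction l as [|f l IH]; simpl; intros Cl Hl v Hv.
  - rewrite (RInt_ext _ (fun _ => 0)); [rewrite RInt_const_R; apply Rmult_0_r|].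
    intros t _; rewrite Hv; apply Rmult_0_r.
  - destruct Hv as (c & v' & Hv' & E).
    pose proof (in_span_continuous l ltac:(auto) v' Hv') as Cv.
    pose proof (Cl f ltac:(auto)) as Cf.
    rewrite (RInt_ext _ (fun t => c * (k t * f t) + 1 * (k t * v' t)));
      [|intros t _; rewrite E; simpl; ring].
    rewrite (RInt_lin2 (fun t => k t * f t) (fun t => k t * v' t)) by (intros; cont).
    rewrite Hl, (IH ltac:(auto) ltac:(auto) v' Hv') by auto.
    rewrite !Rmult_0_r; apply Rplus_0_l.
Qed.

(** For a weight [w >= 0] this is linear independence in the space of square integrable functions
    with density [w] on [[0, T]]. *)
Fixpoint weighted_indep (w : R -> R) (T : R) (l : list (R -> R)) : Prop :=
  match l with
  | nil => True
  | cons f l' => weighted_indep w T l' /\ forall v, in_span l' v ->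
      0 < RInt (fun t => w t * (f t - v t) * (f t - v t)) 0 T
  end.

(* Gram-Schmidt: [b = w (f - vf)], with [vf] in the span of the tail of [l], has
   zero moments against the tail and a positive one against [f]. *)
Lemma moment_correction (w : R -> R) (T W B : R) (l : list (R -> R)) :
  0 <= T -> (forall t, continuous w t) -> (forall t, Rabs (w t) <= W) ->
  (forall f, In f l -> forall t, continuous f t) ->
  (forall f, In f l -> forall t, Rabs (f t) <= B) ->
  weighted_indep w T l ->
  exists K, 0 <= K /\ forall H m,
    (forall t, continuous H t) -> (forall t, Rabs (H t) <= m) ->
    exists v, in_span l v /\ (forall t, Rabs (w t * v t) <= K * m) /\
      forall f, In f l -> RInt (fun t => (H t - w t * v t) * f t) 0 T = 0.
Proof.
  intros HT Cw HW; induction l as [|f l IH]; simpl; intros Cl Bl Hi.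
  - exists 0; split; [lra|]; intros H m CH Hm; exists (fun _ => 0).
    repeat split; [|tauto].
    intros t; rewrite Rmult_0_r, Rabs_R0; lra.
  - destruct Hi as [Hi Hf].
    destruct (IH ltac:(auto) ltac:(auto) Hi) as (K & HK & Hcor); clear IH.
    pose proof (Cl f ltac:(auto)) as Cf; pose proof (Bl f ltac:(auto)) as Bf.
    assert (HB : 0 <= B) by (eapply Rle_trans; [apply Rabs_pos|apply (Bf 0)]).
    assert (HW0 : 0 <= W) by (eapply Rle_trans; [apply Rabs_pos|apply (HW 0)]).
    (* Correcting the function [w * f] itself yields [vf], the projection of [f] onto the span of
       the tail. *)
    destruct (Hcor (fun t => w t * f t) (W * B)) as (vf & Svf & Bvf & Ovf).
    { intros; cont. }
    { intros t; rewrite Rabs_mult; apply Rmult_le_compat; auto using Rabs_pos. }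
    specialize (Hf vf Svf).
    pose proof (in_span_continuous l ltac:(auto) vf Svf) as Cvf.
    set (b := fun t => w t * f t - w t * vf t).
    assert (Cb : forall t, continuous b t) by (intros; unfold b; cont).
    set (D := RInt (fun t => w t * (f t - vf t) * (f t - vf t)) 0 T) in *.
    (* As [b] is orthogonal to the tail, hence to [vf], its moment against [f] equals the squared
       distance [D]. *)
    assert (HD : RInt (fun t => b t * f t) 0 T = D).
    { pose proof (in_span_orthogonal T l b Cb ltac:(auto) Ovf vf Svf) as Ho.
      unfold D.
      rewrite (RInt_ext (fun t => w t * (f t - vf t) * (f t - vf t))
                 (fun t => 1 * (b t * f t) + (-1) * (b t * vf t)))
        by (intros t _; unfold b; simpl; ring).
      rewrite (RInt_lin2 (fun t => b t * f t) (fun t => b t * vf t)) by (intros; cont).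
      rewrite Ho, Rmult_0_r, Rplus_0_r, Rmult_1_l; reflexivity. }
    set (S := W * B + K * (W * B)).
    assert (HS : 0 <= S) by (unfold S; assert (0 <= W * B) by (apply Rmult_le_pos; lra); nra).
    assert (Hb : forall t, Rabs (b t) <= S).
    { intros t; unfold b, S, Rminus; eapply Rle_trans; [apply Rabs_triang|].
      rewrite Rabs_Ropp; apply Rplus_le_compat; [|apply Bvf].
      rewrite Rabs_mult; apply Rmult_le_compat; auto using Rabs_pos. }
    (* [K * m] bounds the correction [w * v1] for the tail, [T * ((1 + K) * B) * m] bounds the
       moment [J] left against [f], and [S] bounds [b]; the additional correction is [J / D * b]. *)
    exists (K + T * ((1 + K) * B) / D * S); split.
    { assert (0 <= T * ((1 + K) * B) / D * S); [|lra].
      repeat apply Rmult_le_pos; try lra; left; apply Rinv_0_lt_compat, Hf. }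
    intros H m CH Hm.
    destruct (Hcor H m CH Hm) as (v1 & Sv1 & Bv1 & Ov1).
    pose proof (in_span_continuous l ltac:(auto) v1 Sv1) as Cv1.
    set (g := fun t => H t - w t * v1 t).
    assert (Cg : forall t, continuous g t) by (intros; unfold g; cont).
    set (J := RInt (fun t => g t * f t) 0 T).
    assert (HJ : Rabs J <= T * ((1 + K) * B) * m).
    { replace (T * ((1 + K) * B) * m) with ((T - 0) * (((1 + K) * m) * B)) by ring.
      apply abs_RInt_le_const; [exact HT|apply ex_RInt_cont; intros; cont|].
      intros t _; rewrite Rabs_mult; apply Rmult_le_compat; auto using Rabs_pos.
      unfold g, Rminus; eapply Rle_trans; [apply Rabs_triang|].
      rewrite Rabs_Ropp; pose proof (Hm t); pose proof (Bv1 t); lra. }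
    exists (fun t => v1 t + J / D * (f t - vf t)).
    assert (Hres : forall e, (forall t, continuous e t) ->
      RInt (fun t => (H t - w t * (v1 t + J / D * (f t - vf t))) * e t) 0 T =
      RInt (fun t => g t * e t) 0 T - J / D * RInt (fun t => b t * e t) 0 T).
    { intros e Ce.
      rewrite (RInt_ext _ (fun t => 1 * (g t * e t) + - (J / D) * (b t * e t)))
        by (intros t _; unfold g, b; simpl; ring).
      rewrite (RInt_lin2 (fun t => g t * e t) (fun t => b t * e t)) by (intros; cont).
      rewrite Rmult_1_l, Ropp_mult_distr_l_reverse; reflexivity. }
    repeat split.
    + exists (J / D), (fun t => v1 t + - (J / D) * vf t); split.
      * apply in_span_add; assumption.
      * intros t; ring.
    + intros t.
      replace (w t * (v1 t + J / D * (f t - vf t))) with (w t * v1 t + J / D * b t)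
        by (unfold b; ring).
      eapply Rle_trans; [apply Rabs_triang|].
      rewrite Rmult_plus_distr_r; apply Rplus_le_compat; [apply Bv1|].
      rewrite Rabs_mult.
      replace (T * ((1 + K) * B) / D * S * m) with (T * ((1 + K) * B) * m / D * S)
        by (field; apply Rgt_not_eq, Hf).
      apply Rmult_le_compat; auto using Rabs_pos.
      unfold Rdiv; rewrite Rabs_mult, (Rabs_pos_eq (/ D))
        by (left; apply Rinv_0_lt_compat, Hf).
      apply Rmult_le_compat_r; [left; apply Rinv_0_lt_compat, Hf|exact HJ].
    + intros e [<-|He]; rewrite Hres by auto.
      * rewrite HD; unfold J; field; apply Rgt_not_eq, Hf.
      * pose proof (Ov1 e He : RInt (fun t => g t * e t) 0 T = 0) as O1.
        pose proof (Ovf e He : RInt (fun t => b t * e t) 0 T = 0) as O2.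
        rewrite O1, O2; ring.
Qed.

(** * Periodic bump functions *)

Definition bump (c d t : R) : R := Rmax 0 (cos (t - c) - cos d).

Lemma bump_continuous c d t : continuous (bump c d) t.
Proof.
  apply (cont_max0 (fun s => cos (s - c) - cos d)).
  apply cont_minus; [|apply continuous_const].
  apply (continuous_comp (fun s => s - c) cos).
  - cont.
  - apply continuity_pt_filterlim, continuity_cos.
Qed.

Lemma bump_nonneg c d t : 0 <= bump c d t.
Proof. apply Rmax_l. Qed.

Lemma bump_bound c d t : Rabs (bump c d t) <= 2.
Proof.
  rewrite Rabs_pos_eq by apply bump_nonneg; unfold bump.
  pose proof (COS_bound (t - c)); pose proof (COS_bound d).
  apply Rmax_lub; lra.
Qed.

Lemma bump_periodic c d t : bump c d (t + 2 * PI) = bump c d t.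
Proof.
  unfold bump; replace (t + 2 * PI - c) with (t - c + 2 * PI) by ring.
  rewrite cos_plus, cos_2PI, sin_2PI, Rmult_0_r, Rmult_1_r, Rminus_0_r; reflexivity.
Qed.

Lemma cos_Rabs u : cos (Rabs u) = cos u.
Proof. unfold Rabs; destruct (Rcase_abs u); [apply cos_neg|reflexivity]. Qed.

Lemma bump_pos c d t : 0 < d <= PI -> Rabs (t - c) < d -> 0 < bump c d t.
Proof.
  intros Hd Ht; unfold bump; apply Rlt_le_trans with (cos (t - c) - cos d); [|apply Rmax_r].
  pose proof (Rabs_pos (t - c)).
  pose proof (cos_decreasing_1 (Rabs (t - c)) d) as H0; rewrite cos_Rabs in H0; lra.
Qed.

(** On the period centred at [c] the cosine decreases with the distance to [c]. With [bump_pos], the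
    bump is positive exactly at distance less than [d] from [c] modulo the period. *)
Lemma bump_support c d t : 0 < d <= PI -> bump c d t <> 0 ->
  exists k, Rabs (t + IZR k * (2 * PI) - c) < d.
Proof.
  intros Hd Hb; pose proof PI_RGT_0 as HPI.
  destruct (shift_into_period (2 * PI) (c - PI) t ltac:(lra)) as [k Hk]; exists k.
  rewrite <- (periodic_IZR (bump c d) (2 * PI) (bump_periodic c d) k) in Hb.
  set (s := t + IZR k * (2 * PI)) in *.
  apply Rnot_le_lt; intros Hle; apply Hb.
  unfold bump; apply Rmax_left.
  assert (Rabs (s - c) <= PI) by (apply Rabs_le; lra).
  pose proof (cos_decr_1 d (Rabs (s - c))) as H0; rewrite cos_Rabs in H0; lra.
Qed.

(** * Plane vectors and norms *)

(** Parametrizes the whole line through [x] and [y]; [seg_inside] has to consider parameters outside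
    [[0, 1]]. *)
Definition seg (x y : vec) (u : R) : vec := vadd x (vscal u (vsub y x)).

Ltac vec_ring := unfold seg, vadd, vsub, vscal, dot, det2, rot; simpl; ring.
Ltac vec_eq := unfold seg, vadd, vsub, vscal, rot; simpl; f_equal; try ring.

Lemma vec_sub_neq (x y : vec) : x <> y -> 0 < dot (vsub x y) (vsub x y).
Proof.
  destruct x as [a b], y as [c d]; unfold dot, vsub; simpl; intros H.
  destruct (Req_dec a c) as [->|H1].
  - assert (Hbd : b - d <> 0) by (intros E; apply H; f_equal; lra).
    pose proof (Rsqr_pos_lt _ Hbd); unfold Rsqr in *; nra.
  - assert (Hac : a - c <> 0) by lra.
    pose proof (Rsqr_pos_lt _ Hac); pose proof (Rle_0_sqr (b - d)); unfold Rsqr in *; lra.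
Qed.

Lemma enorm_pos (x y : vec) : x <> y -> 0 < enorm (vsub x y).
Proof. intros H; apply sqrt_lt_R0, vec_sub_neq, H. Qed.

Lemma enorm_sqr (x : vec) : enorm x * enorm x = dot x x.
Proof. apply sqrt_sqrt; unfold dot; nra. Qed.

Lemma dot_le_enorm (x y : vec) : Rabs (dot x y) <= enorm x * enorm y.
Proof.
  unfold enorm; rewrite <- sqrt_mult by (unfold dot; nra).
  rewrite <- sqrt_Rsqr_abs; apply sqrt_le_1_alt; unfold Rsqr, dot.
  destruct x as [a b], y as [c d]; simpl.
  (* Lagrange's identity: this square is the defect in the Cauchy-Schwarz inequality. *)
  assert (0 <= (a * d - b * c) * (a * d - b * c)) by apply Rle_0_sqr. nra.
Qed.

Lemma norm_scal_nonneg (N : vec -> R) (HN : is_norm N) t x : 0 <= t -> N (vscal t x) = t * N x.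
Proof. destruct HN as (_ & H & _); intros Ht; rewrite H, Rabs_pos_eq; auto. Qed.

Lemma norm_vopp (N : vec -> R) (HN : is_norm N) x : N (vscal (-1) x) = N x.
Proof.
  destruct HN as (_ & H & _); rewrite H, Rabs_left by lra; ring.
Qed.

Lemma norm_nonneg (N : vec -> R) (HN : is_norm N) x : 0 <= N x.
Proof.
  pose proof (norm_vopp N HN x) as Ho; pose proof (norm_scal_nonneg N HN 0 x) as H0.
  destruct HN as (_ & _ & H).
  specialize (H x (vscal (-1) x)).
  replace (vadd x (vscal (-1) x)) with (vscal 0 x) in H by vec_eq.
  lra.
Qed.

Lemma norm_seg (N : vec -> R) (HN : is_norm N) x y u :
  0 <= u <= 1 -> N (seg x y u) <= (1 - u) * N x + u * N y.
Proof.
  intros Hu.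
  replace (seg x y u) with (vadd (vscal (1 - u) x) (vscal u y)) by vec_eq.
  rewrite <- (norm_scal_nonneg N HN (1 - u)), <- (norm_scal_nonneg N HN u) by lra.
  apply HN.
Qed.

(** Provides the inner radius: the Euclidean disc of radius [r] lies in the unit ball of [N]. The
    two coordinate vectors control [N], and the [+ 1] in [K] makes positivity immediate. *)
Lemma norm_le_enorm (N : vec -> R) (HN : is_norm N) :
  exists r, 0 < r /\ forall w, r * N w <= enorm w.
Proof.
  pose proof (norm_nonneg N HN (1, 0)) as P1; pose proof (norm_nonneg N HN (0, 1)) as P2.
  set (K := N (1, 0) + N (0, 1) + 1).
  exists (/ K); assert (HK : 0 < K) by (unfold K; lra); split; [apply Rinv_0_lt_compat, HK|].
  intros w; apply Rmult_le_reg_l with K; [exact HK|].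
  rewrite <- Rmult_assoc, Rinv_r, Rmult_1_l by lra.
  replace w with (vadd (vscal (fst w) (1, 0)) (vscal (snd w) (0, 1))) at 1
    by (destruct w; vec_eq).
  assert (H1 : Rabs (fst w) <= enorm w).
  { unfold enorm; rewrite <- sqrt_Rsqr_abs; apply sqrt_le_1_alt; unfold Rsqr, dot; nra. }
  assert (H2 : Rabs (snd w) <= enorm w).
  { unfold enorm; rewrite <- sqrt_Rsqr_abs; apply sqrt_le_1_alt; unfold Rsqr, dot; nra. }
  assert (H0 : 0 <= enorm w) by apply sqrt_pos.
  destruct HN as (_ & Hs & Ht).
  eapply Rle_trans; [apply Ht|]; rewrite 2!Hs; unfold K.
  pose proof (Rabs_pos (fst w)); pose proof (Rabs_pos (snd w)); nra.
Qed.

(** Strict convexity is assumed at midpoints only. If an end point has norm less than 1, convexity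
    suffices; otherwise the point lies on one of the two halves of the segment, each having the
    midpoint, of norm less than 1, as an end. *)
Lemma norm_seg_lt (N : vec -> R) (HN : is_norm N) (HS : strictly_convex N) x y u :
  N x <= 1 -> N y <= 1 -> x <> y -> 0 < u < 1 -> N (seg x y u) < 1.
Proof.
  intros Hx Hy Hxy Hu.
  pose proof (norm_seg N HN x y u ltac:(lra)) as H.
  destruct (Rlt_dec (N x) 1) as [h|h]; [nra|].
  destruct (Rlt_dec (N y) 1) as [h'|h']; [nra|].
  pose proof (HS x y ltac:(lra) ltac:(lra) Hxy) as Hm.
  set (m := vscal (/ 2) (vadd x y)) in Hm.
  destruct (Rle_dec u (/ 2)) as [k|k].
  - pose proof (norm_seg N HN x m (2 * u) ltac:(lra)) as H'.
    replace (seg x m (2 * u)) with (seg x y u) in H' by (unfold m; vec_eq; field).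
    nra.
  - pose proof (norm_seg N HN m y (2 * u - 1) ltac:(lra)) as H'.
    replace (seg m y (2 * u - 1)) with (seg x y u) in H' by (unfold m; vec_eq; field).
    nra.
Qed.

Lemma seg_neq x y u : x <> y -> u <> 0 -> x <> seg x y u.
Proof.
  intros Hxy Hu E; apply Hxy.
  destruct x as [a b], y as [c d]; unfold seg, vadd, vscal, vsub in E; simpl in E.
  injection E; intros E2 E1.
  assert (E3 : u * (c - a) = 0) by lra; assert (E4 : u * (d - b) = 0) by lra.
  apply Rmult_integral in E3; apply Rmult_integral in E4.
  f_equal; lra.
Qed.

(** For a parameter outside [[0, 1]], one of [x], [y] would lie strictly between the other one and
    the new point, and so have norm less than 1. *)
Lemma seg_inside (N : vec -> R) (HN : is_norm N) (HS : strictly_convex N) x y u :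
  N x = 1 -> N y = 1 -> x <> y -> N (seg x y u) <= 1 -> 0 <= u <= 1.
Proof.
  intros Hx Hy Hxy Hw; split; apply Rnot_lt_le; intros Hu.
  - assert (Hyw : y <> seg x y u).
    { replace (seg x y u) with (seg y x (1 - u)) by vec_eq.
      apply seg_neq; [auto|lra]. }
    assert (Hi : 0 < / (1 - u) < 1).
    { split; [apply Rinv_0_lt_compat; lra|].
      rewrite <- Rinv_1; apply Rinv_lt_contravar; lra. }
    pose proof (norm_seg_lt N HN HS y (seg x y u) (/ (1 - u)) ltac:(lra) Hw Hyw Hi) as H.
    replace (seg y (seg x y u) (/ (1 - u))) with x in H; [lra|].
    destruct x, y; vec_eq; field; lra.
  - assert (Hyw : x <> seg x y u) by (apply seg_neq; [auto|lra]).
    assert (Hi : 0 < / u < 1).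
    { split; [apply Rinv_0_lt_compat; lra|].
      rewrite <- Rinv_1; apply Rinv_lt_contravar; lra. }
    pose proof (norm_seg_lt N HN HS x (seg x y u) (/ u) ltac:(lra) Hw Hyw Hi) as H.
    replace (seg x (seg x y u) (/ u)) with y in H; [lra|].
    destruct x, y; vec_eq; field; lra.
Qed.

Lemma norm_seg_continuous (N : vec -> R) (HN : is_norm N) x y u :
  continuous (fun s => N (seg x y s)) u.
Proof.
  apply continuity_pt_filterlim.
  intros eps Heps.
  (* The map is Lipschitz with constant [N (vsub y x)]; adding 1 permits division when [x = y]. *)
  set (K := N (vsub y x) + 1).
  pose proof (norm_nonneg N HN (vsub y x)) as HK.
  assert (HKp : 0 < K) by (unfold K; lra).
  exists (eps / K); split; [apply Rdiv_lt_0_compat; lra|].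
  intros s [_ Hs]; simpl in *; unfold Rdist in *.
  assert (Hlip : forall a b, N (seg x y a) - N (seg x y b) <= Rabs (a - b) * N (vsub y x)).
  { intros a b; destruct HN as (_ & Hsc & Ht); rewrite <- Hsc.
    specialize (Ht (seg x y b) (vscal (a - b) (vsub y x))).
    replace (vadd (seg x y b) (vscal (a - b) (vsub y x))) with (seg x y a) in Ht by vec_eq.
    lra. }
  apply Rle_lt_trans with (Rabs (s - u) * N (vsub y x)).
  - pose proof (Hlip s u); pose proof (Hlip u s) as H2; rewrite Rabs_minus_sym in H2.
    apply Rabs_le; lra.
  - apply Rle_lt_trans with (Rabs (s - u) * K).
    + apply Rmult_le_compat_l; [apply Rabs_pos|unfold K; lra].
    + apply Rlt_le_trans with (eps / K * K); [apply Rmult_lt_compat_r; assumption|].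
      right; field; lra.
Qed.

(** * Chord frames *)

Definition chord_dir (zp zm : vec) : vec := vscal (/ enorm (vsub zp zm)) (vsub zp zm).

(** Signed distance to the chord line, positive on the side of [- nu], where the counterclockwise
    arc from [zm] to [zp] will lie. *)
Definition height (zp zm z : vec) : R := dot zp (nu zp zm) - dot z (nu zp zm).

Section Frame.

Variables zp zm : vec.
Hypothesis Hneq : zp <> zm.

Let n := nu zp zm.
Let tau := chord_dir zp zm.
Let L := enorm (vsub zp zm).

Lemma nu_rot_chord_dir : nu zp zm = rot (chord_dir zp zm).
Proof. unfold nu, chord_dir; vec_eq. Qed.

Lemma chord_dir_unit : dot (chord_dir zp zm) (chord_dir zp zm) = 1.
Proof.
  pose proof (enorm_pos _ _ Hneq) as HL; pose proof (enorm_sqr (vsub zp zm)) as E.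
  transitivity (dot (vsub zp zm) (vsub zp zm) / (enorm (vsub zp zm) * enorm (vsub zp zm))).
  - unfold chord_dir; generalize (vsub zp zm) HL; intros p Hp.
    unfold dot at 1, vscal; simpl; unfold dot at 1; field; lra.
  - rewrite <- E; field; lra.
Qed.

Lemma frame_unit : enorm n = 1 /\ enorm tau = 1 /\ dot tau n = 0.
Proof.
  pose proof chord_dir_unit as H; fold tau in H.
  unfold n; rewrite nu_rot_chord_dir; fold tau; repeat split.
  - unfold enorm; replace (dot (rot tau) (rot tau)) with (dot tau tau) by vec_ring.
    rewrite H; apply sqrt_1.
  - unfold enorm; rewrite H; apply sqrt_1.
  - vec_ring.
Qed.

Lemma chord_eq : vsub zp zm = vscal L tau.
Proof.
  pose proof (enorm_pos _ _ Hneq) as HL; fold L in HL.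
  unfold tau, chord_dir; fold L; destruct (vsub zp zm); unfold vscal; simpl; f_equal; field; lra.
Qed.

Lemma frame_length : dot zp tau - dot zm tau = L.
Proof.
  transitivity (dot (vsub zp zm) tau); [vec_ring|].
  rewrite chord_eq; transitivity (L * dot tau tau); [vec_ring|].
  unfold tau; rewrite chord_dir_unit; ring.
Qed.

Lemma frame_dot v w : dot v w = dot v tau * dot w tau + dot v n * dot w n.
Proof.
  unfold n; rewrite nu_rot_chord_dir; fold tau.
  (* Homogenizing with the factor [dot tau tau = 1] turns the claim into a polynomial identity. *)
  transitivity (dot v w * dot tau tau); [unfold tau; rewrite chord_dir_unit; ring|vec_ring].
Qed.

Lemma frame_det2 v w : det2 v w = dot v tau * dot w n - dot v n * dot w tau.
Proof.
  unfold n; rewrite nu_rot_chord_dir; fold tau.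
  transitivity (det2 v w * dot tau tau); [unfold tau; rewrite chord_dir_unit; ring|vec_ring].
Qed.

Lemma chord_dot_normal u : dot (seg zm zp u) n = dot zp n.
Proof.
  destruct frame_unit as (_ & _ & E).
  transitivity (dot zp n + (u - 1) * dot (vsub zp zm) n); [vec_ring|].
  rewrite chord_eq.
  replace (dot (vscal L tau) n) with (L * dot tau n) by vec_ring; rewrite E; ring.
Qed.

Lemma height_zm : height zp zm zm = 0.
Proof.
  unfold height; fold n; rewrite <- (chord_dot_normal 0).
  replace (seg zm zp 0) with zm by (destruct zm; vec_eq); ring.
Qed.

(** Makes the normalization explicit, so that the sign of the height is that of a polynomial in the
    points. *)
Lemma height_eq z :
  height zp zm z = / L * dot (vsub zm z) (rot (vsub zp zm)).
Proof.
  transitivity (height zp zm z - height zp zm zm); [rewrite height_zm; ring|].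
  unfold height, nu; fold L; vec_ring.
Qed.

Lemma chord_line w :
  dot w n = dot zp n -> w = seg zm zp ((dot w tau - dot zm tau) / L).
Proof.
  intros Hw; pose proof (enorm_pos _ _ Hneq) as HL; fold L in HL.
  assert (Hm : dot zm n = dot zp n).
  { pose proof height_zm as H; unfold height in H; fold n in H; lra. }
  set (q := dot w tau - dot zm tau).
  assert (E : vsub w zm = vscal q tau).
  { assert (Hx : vsub w zm = vadd (vscal q tau) (vscal (dot w n - dot zm n) n)).
    { transitivity (vscal (dot tau tau) (vsub w zm)).
      - unfold tau; rewrite chord_dir_unit; destruct (vsub w zm); vec_eq.
      - unfold n, q; rewrite nu_rot_chord_dir; fold tau.
        unfold vscal, vadd, vsub, rot, dot; simpl; f_equal; ring. }
    rewrite Hx, Hw, Hm; destruct tau; vec_eq. }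
  unfold seg; rewrite chord_eq.
  replace (vscal (q / L) (vscal L tau)) with (vscal q tau)
    by (unfold vscal; simpl; f_equal; field; split; apply Rgt_not_eq, HL).
  rewrite <- E; destruct w, zm; vec_eq.
Qed.

(** Since [rot n = - tau], the substitution [s = - L * u + dot zm (rot n)] maps [[0, 1]] onto the
    chord, starting at [zm]; the absolute value removes the sign. *)
Lemma c1D_unit_interval (N : vec -> R) (HN : is_norm N) :
  c1D N zp zm =
  2 * Rabs (L * RInt (fun u => 1 - N (seg zm zp u) * N (seg zm zp u)) 0 1).
Proof.
  pose proof (enorm_pos _ _ Hneq) as HL; fold L in HL.
  unfold c1D; fold n; f_equal.
  set (f := fun s => 1 - N (vadd (vscal (dot zp n) n) (vscal s (rot n))) ^ 2).
  assert (Cf : forall s, continuous f s).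
  { intros s; unfold f.
    set (y := vadd (vscal (dot zp n) n) (rot n)).
    apply continuous_ext with
      (fun s => 1 - N (seg (vscal (dot zp n) n) y s) * N (seg (vscal (dot zp n) n) y s)).
    - intros t; simpl; rewrite Rmult_1_r.
      replace (seg (vscal (dot zp n) n) y t)
        with (vadd (vscal (dot zp n) n) (vscal t (rot n))) by (unfold y; vec_eq).
      reflexivity.
    - apply cont_minus; [apply continuous_const|].
      apply cont_mult; apply norm_seg_continuous, HN. }
  assert (Er : rot n = vscal (-1) tau)
    by (unfold n; rewrite nu_rot_chord_dir; fold tau; destruct tau; vec_eq).
  assert (Ed : forall w, dot w (rot n) = - dot w tau) by (intros w; rewrite Er; vec_ring).
  pose proof frame_length as EL.
  assert (E := RInt_comp_lin f (- L) (dot zm (rot n)) 0 1 ltac:(apply ex_RInt_cont, Cf)).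
  replace (- L * 0 + dot zm (rot n)) with (dot zm (rot n)) in E by ring.
  replace (- L * 1 + dot zm (rot n)) with (dot zp (rot n)) in E by (rewrite !Ed; lra).
  rewrite <- E, <- Rabs_Ropp; f_equal.
  set (g := fun u => 1 - N (seg zm zp u) * N (seg zm zp u)).
  assert (Cg : forall u, continuous g u).
  { intros u; apply cont_minus; [apply continuous_const|].
    apply cont_mult; apply norm_seg_continuous, HN. }
  replace (L * RInt g 0 1) with (- (- L * RInt g 0 1)) by ring.
  rewrite (RInt_scal_cont g (- L) 0 1 Cg).
  f_equal; apply RInt_ext; intros u _.
  change (- L * f (- L * u + dot zm (rot n)) = - L * g u).
  f_equal; unfold f, g.
  replace (vadd (vscal (dot zp n) n) (vscal (- L * u + dot zm (rot n)) (rot n)))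
    with (seg zm zp u); [ring|].
  rewrite (chord_line (vadd (vscal (dot zp n) n) (vscal (- L * u + dot zm (rot n)) (rot n)))).
  - f_equal.
    rewrite Er at 2; rewrite Ed.
    replace (dot (vadd (vscal (dot zp n) n) (vscal (- L * u + - dot zm tau) (vscal (-1) tau))) tau)
      with (dot zp n * dot tau n + (L * u + dot zm tau) * dot tau tau) by vec_ring.
    destruct frame_unit as (_ & _ & ->).
    unfold tau; rewrite chord_dir_unit; fold tau; field; lra.
  - destruct frame_unit as (Hn & _ & Ht).
    pose proof (enorm_sqr n) as En; rewrite Hn in En.
    rewrite Er.
    replace (dot (vadd (vscal (dot zp n) n)
               (vscal (- L * u + dot zm (vscal (-1) tau)) (vscal (-1) tau))) n)
      with (dot zp n * dot n n + - (- L * u + dot zm (vscal (-1) tau)) * dot tau n) by vec_ring.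
    rewrite Ht, <- En; ring.
Qed.

End Frame.

(** * Strictly convex curves *)

Section Curve.

Variables (N : vec -> R) (gam dgam : R -> vec).
Hypothesis HN : is_norm N.
Hypothesis HS : strictly_convex N.
Hypothesis HC : C1_away_from_0 N.
Hypothesis HG : arclength_param N gam dgam.

Lemma gam_periodic t : gam (t + 2 * PI) = gam t.
Proof. destruct HG as (_ & _ & _ & H & _); apply H. Qed.

Lemma gam_unit t : N (gam t) = 1.
Proof. destruct HG as (_ & _ & _ & _ & H & _); apply H. Qed.

Lemma gam_dot_derive n t : is_derive (fun s => dot (gam s) n) t (dot (dgam t) n).
Proof.
  assert (Hd : is_derive gam t (dgam t)) by apply HG.
  assert (H1 : is_derive (fun s => fst (gam s)) t (fst (dgam t))).
  { apply (filterdiff_comp' gam (fun z : vec => fst z) t _ (fun z : vec => fst z) Hd).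
    apply filterdiff_linear, is_linear_fst. }
  assert (H2 : is_derive (fun s => snd (gam s)) t (snd (dgam t))).
  { apply (filterdiff_comp' gam (fun z : vec => snd z) t _ (fun z : vec => snd z) Hd).
    apply filterdiff_linear, is_linear_snd. }
  unfold dot.
  evar_last.
  - apply (is_derive_plus (fun s => fst (gam s) * fst n) (fun s => snd (gam s) * snd n)).
    + apply (is_derive_scal_l _ _ _ (fst n) H1).
    + apply (is_derive_scal_l _ _ _ (snd n) H2).
  - reflexivity.
Qed.

Lemma dgam_dot_continuous n t : continuous (fun s => dot (dgam s) n) t.
Proof.
  assert (Hd : continuous dgam t) by apply HG.
  unfold dot; apply cont_plus; apply cont_mult; try apply continuous_const.
  - apply (continuous_comp dgam fst); [exact Hd|apply continuous_fst].
  - apply (continuous_comp dgam snd); [exact Hd|apply continuous_snd].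
Qed.

Lemma gam_dot_continuous n t : continuous (fun s => dot (gam s) n) t.
Proof. apply (continuous_of_derive _ _ (gam_dot_derive n)). Qed.

Lemma dgam_unit t : dot (dgam t) (dgam t) = 1.
Proof.
  rewrite <- enorm_sqr; replace (enorm (dgam t)) with 1; [ring|].
  symmetry; destruct HG as (_ & _ & H & _); apply H.
Qed.

Lemma gam_neq0 t : gam t <> (0, 0).
Proof.
  intros E; pose proof (gam_unit t) as H.
  pose proof (norm_scal_nonneg N HN 0 (gam t) ltac:(lra)) as H0.
  replace (vscal 0 (gam t)) with (gam t) in H0; [lra|].
  rewrite E; vec_eq.
Qed.

(** * Supporting lines and the position of arcs *)

Lemma norm_derive_line (G x w : vec) :
  filterdiff N (locally x) (fun h => dot G h) ->
  is_derive (fun s => N (vadd x (vscal s w))) 0 (dot G w).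
Proof.
  intros HF.
  assert (Hl : is_derive (fun s : R => vadd x (vscal s w)) 0 w).
  { evar_last.
    - apply (is_derive_plus (fun _ : R => x) (fun s : R => scal s w)).
      + apply is_derive_const.
      + apply (is_derive_scal_l (fun s : R => s) 0 1 w), (is_derive_id (K := R_AbsRing)).
    - destruct w as [w1 w2]; unfold plus, zero, scal; simpl;
        unfold prod_plus, prod_zero, prod_scal, plus, zero, scal; simpl;
        unfold mult; simpl; f_equal; ring. }
  eapply filterdiff_ext_lin.
  - apply (filterdiff_comp' (fun s : R => vadd x (vscal s w)) N 0 _ (fun h => dot G h) Hl).
    replace (vadd x (vscal 0 w)) with x; [exact HF|].
    destruct x; vec_eq.
  - intros y; unfold dot, scal; simpl; unfold prod_scal, scal, mult; simpl; unfold mult; simpl; ring.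
Qed.

(* The differential of [N] at [gam t] kills [dgam t], so it is the functional
   [w |-> det2 w (dgam t) / det2 (gam t) (dgam t)], of dual norm 1. *)
Lemma gam_support_pos t :
  0 < det2 (gam t) (dgam t) /\
  forall w, det2 w (dgam t) <= N w * det2 (gam t) (dgam t).
Proof.
  destruct HC as [g Hg].
  destruct (Hg (gam t) (gam_neq0 t)) as [HF _].
  set (G := g (gam t)) in *.
  assert (Htan : dot G (dgam t) = 0).
  { apply (derive_0_const (fun s => N (gam s)) t _ 1 gam_unit).
    eapply filterdiff_ext_lin.
    - apply (filterdiff_comp' gam N t (fun y => scal y (dgam t)) (fun h => dot G h)); [apply HG|exact HF].
    - intros y; unfold dot, scal; simpl; unfold prod_scal, scal, mult; simpl; unfold mult; simpl; ring. }
  assert (Hline : forall w m, (forall s, 0 < s < 1 -> N (vadd (gam t) (vscal s w)) <= 1 + s * m) ->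
                  dot G w <= m).
  { intros w m Hs.
    apply (derive_le_slope (fun s => N (vadd (gam t) (vscal s w))) 0 _ m 1); [lra| |].
    - apply norm_derive_line, HF.
    - intros s Hs0; rewrite Rplus_0_l.
      replace (vadd (gam t) (vscal 0 w)) with (gam t) by (destruct (gam t); vec_eq).
      rewrite gam_unit; auto. }
  assert (Hup : forall w, dot G w <= N w).
  { intros w; apply Hline; intros s Hs.
    rewrite <- (gam_unit t), <- (norm_scal_nonneg N HN s) by lra; apply HN. }
  (* Moving towards the origin decreases [N] at unit rate. With [Hup] this yields Euler's relation
     [dot G (gam t) = 1]. *)
  assert (Hrad : dot G (vscal (-1) (gam t)) <= -1).
  { apply Hline; intros s Hs.
    replace (vadd (gam t) (vscal s (vscal (-1) (gam t)))) with (vscal (1 - s) (gam t)) by vec_eq.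
    rewrite (norm_scal_nonneg N HN), gam_unit by lra; lra. }
  pose proof (Hup (gam t)) as Hrad'; rewrite gam_unit in Hrad'.
  assert (Hpos : 0 <= det2 (gam t) (dgam t))
    by (destruct HG as (_ & _ & _ & _ & _ & _ & _ & H); apply H).
  pose proof (dgam_unit t) as Hu.
  (* [G] is orthogonal to the unit vector [dgam t], hence a multiple of its rotation. Euler's
     relation then makes the determinant nonzero, and the orientation makes it positive. *)
  set (k := fst G * snd (dgam t) - snd G * fst (dgam t)).
  assert (Hk : forall w, dot G w = k * det2 w (dgam t)).
  { intros w.
    transitivity (dot G w * dot (dgam t) (dgam t) - dot G (dgam t) * dot (dgam t) w).
    - rewrite Hu, Htan; ring.
    - unfold k; vec_ring. }
  assert (Hk1 : k * det2 (gam t) (dgam t) = 1).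
  { rewrite <- Hk.
    replace (dot G (vscal (-1) (gam t))) with (- dot G (gam t)) in Hrad by vec_ring; lra. }
  assert (Hb : 0 < det2 (gam t) (dgam t)).
  { destruct Hpos as [Hpos|E]; [exact Hpos|].
    rewrite <- E, Rmult_0_r in Hk1; lra. }
  split; [exact Hb|].
  intros w; specialize (Hup w); rewrite Hk in Hup.
  replace (det2 w (dgam t)) with (k * det2 w (dgam t) * det2 (gam t) (dgam t)).
  - apply Rmult_le_compat_r; lra.
  - transitivity (det2 w (dgam t) * (k * det2 (gam t) (dgam t))); [ring|rewrite Hk1; ring].
Qed.

Lemma gam_support t w : det2 w (dgam t) <= N w * det2 (gam t) (dgam t).
Proof. apply gam_support_pos. Qed.

(** The determinant is the distance from the origin to the tangent line. Test the supporting
    inequality on the outer unit normal [- rot (dgam t)], whose [N] is at most [1 / r]. *)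
Lemma gam_support_ge r t :
  0 < r -> (forall w, r * N w <= enorm w) -> r <= det2 (gam t) (dgam t).
Proof.
  intros Hr H.
  pose proof (gam_support t (vscal (-1) (rot (dgam t)))) as Hs.
  replace (det2 (vscal (-1) (rot (dgam t))) (dgam t)) with (dot (dgam t) (dgam t)) in Hs by vec_ring.
  specialize (H (vscal (-1) (rot (dgam t)))).
  assert (E : enorm (vscal (-1) (rot (dgam t))) = 1).
  { unfold enorm.
    replace (dot (vscal (-1) (rot (dgam t))) (vscal (-1) (rot (dgam t))))
      with (dot (dgam t) (dgam t)) by vec_ring.
    rewrite dgam_unit; apply sqrt_1. }
  rewrite E in H; rewrite dgam_unit in Hs.
  destruct (gam_support_pos t) as [Hb _]; nra.
Qed.

(** Use the supporting inequality at the midpoint of the two points, where [N < 1]. *)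
Lemma gam_support_strict s t : gam s <> gam t -> det2 (vsub (gam s) (gam t)) (dgam t) < 0.
Proof.
  intros Hst.
  pose proof (norm_seg_lt N HN HS (gam t) (gam s) (/ 2)) as Hm.
  rewrite !gam_unit in Hm; specialize (Hm ltac:(lra) ltac:(lra) ltac:(auto) ltac:(lra)).
  pose proof (gam_support t (seg (gam t) (gam s) (/ 2))) as H.
  destruct (gam_support_pos t) as [Hb _].
  replace (det2 (seg (gam t) (gam s) (/ 2)) (dgam t))
    with (det2 (gam t) (dgam t) + / 2 * det2 (vsub (gam s) (gam t)) (dgam t)) in H by vec_ring.
  nra.
Qed.

Lemma gam_injective s t : s <= t < s + 2 * PI -> gam s = gam t -> s = t.
Proof.
  intros Hst E; pose proof PI_RGT_0 as HPI.
  destruct (shift_into_period (2 * PI) 0 s ltac:(lra)) as [k Hk].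
  rewrite Rplus_0_l in Hk.
  pose proof (periodic_IZR gam (2 * PI) gam_periodic k) as P.
  destruct HG as (_ & _ & _ & _ & _ & _ & Hinj & _).
  (* After [s] is moved into [[0, 2 * PI)], the shifted [t] may still lie in the next period. *)
  destruct (Rlt_dec (t + IZR k * (2 * PI)) (2 * PI)) as [h|h].
  - assert (s + IZR k * (2 * PI) = t + IZR k * (2 * PI)); [|lra].
    apply Hinj; [lra|lra|]; rewrite !P; exact E.
  - assert (s + IZR k * (2 * PI) = t + IZR k * (2 * PI) - 2 * PI); [|lra].
    apply Hinj; [lra|lra|].
    rewrite <- (gam_periodic (t + IZR k * (2 * PI) - 2 * PI)).
    replace (t + IZR k * (2 * PI) - 2 * PI + 2 * PI) with (t + IZR k * (2 * PI)) by ring.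
    rewrite !P; exact E.
Qed.

(* [det2 p (dgam tm) < 0] says that the curve leaves the chord on its right;
   by strict convexity it cannot cross the chord line before [tp]. *)
Lemma arc_right_of_chord tm t tp :
  tm < t < tp -> tp < tm + 2 * PI ->
  0 < dot (vsub (gam tm) (gam t)) (rot (vsub (gam tp) (gam tm))).
Proof.
  intros Ht Htp.
  set (p := vsub (gam tp) (gam tm)).
  assert (Hmp : gam tp <> gam tm).
  { intros E; assert (tm = tp) by (apply gam_injective; [lra|auto]); lra. }
  set (h := fun s => dot (vsub (gam tm) (gam s)) (rot p)).
  assert (Hh : forall s, is_derive h s (- dot (dgam s) (rot p))).
  { intros s.
    apply is_derive_ext with (fun s => dot (gam tm) (rot p) - dot (gam s) (rot p)).
    - intros u; unfold h; vec_ring.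
    - evar_last.
      + apply (is_derive_minus (fun _ => dot (gam tm) (rot p)) (fun u => dot (gam u) (rot p))).
        * apply is_derive_const.
        * apply gam_dot_derive.
      + unfold minus, plus, opp, zero; simpl; ring. }
  (* A zero puts [gam s] on the chord line, hence on the chord by [seg_inside]. Its interior points
     have norm less than 1, and injectivity excludes its ends. *)
  assert (Hnz : forall s, tm < s < tp -> h s <> 0).
  { intros s Hs Hz.
    set (u := dot (vsub (gam s) (gam tm)) p / dot p p).
    assert (Hp : 0 < dot p p) by apply vec_sub_neq, Hmp.
    assert (Hseg : gam s = seg (gam tm) (gam tp) u).
    { unfold h in Hz.
      assert (E : vscal (dot p p) (vsub (gam s) (gam tm)) =
                  vscal (dot (vsub (gam s) (gam tm)) p) p).
      { transitivity (vadd (vscal (dot (vsub (gam s) (gam tm)) p) p)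
                           (vscal (dot (vsub (gam tm) (gam s)) (rot p)) (vscal (-1) (rot p)))).
        - unfold vscal, vadd, vsub, dot, rot; simpl; f_equal; ring.
        - rewrite Hz; destruct p; unfold vscal, vadd, vsub, dot, rot; simpl; f_equal; ring. }
      unfold u, seg; fold p.
      replace (vscal (dot (vsub (gam s) (gam tm)) p / dot p p) p)
        with (vscal (/ dot p p) (vscal (dot p p) (vsub (gam s) (gam tm)))).
      - destruct (gam s), (gam tm); unfold vscal, vadd, vsub; simpl; f_equal; field; lra.
      - rewrite E; unfold vscal; simpl; f_equal; field; lra. }
    assert (Hu : 0 <= u <= 1).
    { apply (seg_inside N HN HS (gam tm) (gam tp)); auto using gam_unit.
      rewrite <- Hseg, gam_unit; lra. }
    destruct (Req_dec u 0) as [E0|E0]; [|destruct (Req_dec u 1) as [E1|E1]].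
    - assert (tm = s); [|lra]. apply gam_injective; [lra|].
      rewrite Hseg, E0; destruct (gam tm); vec_eq.
    - assert (s = tp); [|lra]. apply gam_injective; [lra|].
      rewrite Hseg, E1; destruct (gam tm), (gam tp); vec_eq.
    - pose proof (norm_seg_lt N HN HS (gam tm) (gam tp) u) as H.
      rewrite <- Hseg, !gam_unit in H.
      specialize (H ltac:(lra) ltac:(lra) ltac:(auto) ltac:(lra)); lra. }
  pose proof (continuous_of_derive _ _ Hh) as Hcont.
  fold (h t); apply Rnot_le_lt; intros Hle.
  assert (Hneg : h t < 0) by (pose proof (Hnz t Ht); lra).
  assert (Hall : forall s, tm < s < tp -> h s <= 0).
  { intros s Hs; apply Rnot_lt_le; intros Hpos.
    destruct (IVT_gen h s t 0) as [z [Hz1 Hz2]].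
    - intros z; apply continuity_pt_filterlim, Hcont.
    - unfold Rmin, Rmax; destruct (Rle_dec (h s) (h t)); lra.
    - apply (Hnz z); [|exact Hz2].
      revert Hz1; unfold Rmin, Rmax; destruct (Rle_dec s t); lra. }
  (* The strict tangent inequality makes the derivative of [h] at [tm] positive, whereas [h <= 0]
     just after [tm] forces it to be at most 0. *)
  pose proof (gam_support_strict tp tm Hmp) as Hst; fold p in Hst.
  assert (Hh0 : h tm = 0) by (unfold h; vec_ring).
  assert (- dot (dgam tm) (rot p) <= 0).
  { apply (derive_le_slope h tm _ 0 (tp - tm)); [lra|apply Hh|].
    intros s Hs; rewrite Hh0, Rmult_0_r, Rplus_0_l; apply Hall; lra. }
  replace (det2 p (dgam tm)) with (dot (dgam tm) (rot p)) in Hst by vec_ring.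
  lra.
Qed.

(** * Size and periodicity of the curve *)

Lemma dgam_dot_bound n t : enorm n = 1 -> Rabs (dot (dgam t) n) <= 1.
Proof.
  intros Hn; eapply Rle_trans; [apply dot_le_enorm|].
  replace (enorm (dgam t)) with 1; [rewrite Hn; lra|symmetry; destruct HG as (_ & _ & H & _); apply H].
Qed.

Lemma gam_dot_lipschitz n s t :
  enorm n = 1 -> Rabs (dot (gam t) n - dot (gam s) n) <= Rabs (t - s).
Proof.
  intros Hn; rewrite <- (Rmult_1_l (Rabs (t - s))).
  apply (MVT_lipschitz (fun u => dot (gam u) n) _ 1 s t (gam_dot_derive n)).
  intros u; apply dgam_dot_bound, Hn.
Qed.

(** Provides the outer radius, uniform in the direction: at unit speed, one period cannot lead
    farther than [2 * PI] from [gam 0]. *)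
Lemma gam_bounded :
  exists M, 0 < M /\ forall n t, enorm n = 1 -> Rabs (dot (gam t) n) <= M.
Proof.
  pose proof PI_RGT_0 as HPI.
  assert (H0 : 0 <= enorm (gam 0)) by apply sqrt_pos.
  exists (enorm (gam 0) + 2 * PI); split; [lra|].
  intros n t Hn.
  destruct (shift_into_period (2 * PI) 0 t ltac:(lra)) as [k Hk].
  rewrite <- (periodic_IZR gam (2 * PI) gam_periodic k t).
  set (u := t + IZR k * (2 * PI)) in *.
  pose proof (gam_dot_lipschitz n 0 u Hn) as HL.
  pose proof (dot_le_enorm (gam 0) n) as HD; rewrite Hn in HD.
  rewrite (Rabs_pos_eq (u - 0)) in HL by lra.
  pose proof (Rabs_triang (dot (gam u) n - dot (gam 0) n) (dot (gam 0) n)) as HT.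
  replace (dot (gam u) n - dot (gam 0) n + dot (gam 0) n) with (dot (gam u) n) in HT by ring.
  lra.
Qed.

Lemma dgam_dot_periodic n t : dot (dgam (t + 2 * PI)) n = dot (dgam t) n.
Proof.
  rewrite <- (is_derive_unique _ _ _ (gam_dot_derive n t)).
  symmetry; apply is_derive_unique.
  apply is_derive_ext with (fun s => dot (gam (s + 2 * PI)) n).
  - intros s; rewrite gam_periodic; reflexivity.
  - evar_last.
    + apply (is_derive_comp (fun u => dot (gam u) n) (fun s => s + 2 * PI)).
      * apply gam_dot_derive.
      * apply (is_derive_plus (fun s => s) (fun _ => 2 * PI));
          [apply (is_derive_id (K := R_AbsRing))|apply is_derive_const].
    + unfold scal, plus, zero, one, mult; simpl; unfold mult; simpl; ring.
Qed.

(** * Moment correctors on short arcs *)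

Lemma bump_affine_square_pos c d p q :
  0 <= c <= 2 * PI -> 0 < d <= PI -> (p <> 0 \/ q <> (0, 0)) ->
  0 < RInt (fun t => bump c d t * (p + dot (gam t) q) * (p + dot (gam t) q)) 0 (2 * PI).
Proof.
  intros Hc Hd Hpq; pose proof PI_RGT_0 as HPI.
  pose proof (gam_dot_continuous q) as Cq; pose proof (bump_continuous c d) as Cb.
  (* The support of the bump may stick out of [[0, 2 * PI]]; a nontrivial interval remains
     inside. *)
  assert (exists lo hi, 0 <= lo < hi /\ hi <= 2 * PI /\ c - d <= lo /\ hi <= c + d)
    as (lo & hi & Hlo & Hhi & Hlo' & Hhi').
  { exists (Rmax 0 (c - d)), (Rmin (2 * PI) (c + d)).
    unfold Rmax, Rmin; destruct (Rle_dec 0 (c - d)), (Rle_dec (2 * PI) (c + d)); lra. }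
  assert (Hpt : forall t, lo < t < hi -> p + dot (gam t) q <> 0 ->
    0 < RInt (fun t => bump c d t * (p + dot (gam t) q) * (p + dot (gam t) q)) 0 (2 * PI)).
  { intros t Ht Hnz.
    apply (RInt_pos_of_point (fun t => bump c d t * (p + dot (gam t) q) * (p + dot (gam t) q)) _ _ t).
    - intros s; cont.
    - intros s; rewrite Rmult_assoc; apply Rmult_le_pos; [apply bump_nonneg|apply Rle_0_sqr].
    - lra.
    - rewrite Rmult_assoc; apply Rmult_lt_0_compat; [|apply (Rsqr_pos_lt _ Hnz)].
      apply bump_pos; [lra|apply Rabs_def1; lra]. }
  (* An affine function vanishing at three points of this arc would make them collinear, against
     [arc_right_of_chord], unless it is zero. *)
  set (e := (hi - lo) / 4).
  destruct (Req_dec (p + dot (gam (lo + e)) q) 0) as [E1|E1];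
    [|apply (Hpt (lo + e)); [unfold e; lra|exact E1]].
  destruct (Req_dec (p + dot (gam (lo + 2 * e)) q) 0) as [E2|E2];
    [|apply (Hpt (lo + 2 * e)); [unfold e; lra|exact E2]].
  destruct (Req_dec (p + dot (gam (lo + 3 * e)) q) 0) as [E3|E3];
    [|apply (Hpt (lo + 3 * e)); [unfold e; lra|exact E3]].
  exfalso.
  pose proof (arc_right_of_chord (lo + e) (lo + 2 * e) (lo + 3 * e)
                ltac:(unfold e; lra) ltac:(unfold e; lra)) as H.
  set (v := vsub (gam (lo + e)) (gam (lo + 2 * e))) in H.
  set (w := vsub (gam (lo + 3 * e)) (gam (lo + e))) in H.
  assert (Ev : dot v q = 0) by (transitivity (dot (gam (lo + e)) q - dot (gam (lo + 2 * e)) q);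
    [unfold v; vec_ring|lra]).
  assert (Ew : dot w q = 0) by (transitivity (dot (gam (lo + 3 * e)) q - dot (gam (lo + e)) q);
    [unfold w; vec_ring|lra]).
  assert (Eq : q = (0, 0)).
  { assert (F1 : dot v (rot w) * fst q = 0)
      by (transitivity (snd v * dot w q - snd w * dot v q); [vec_ring|rewrite Ev, Ew; ring]).
    assert (F2 : dot v (rot w) * snd q = 0)
      by (transitivity (fst w * dot v q - fst v * dot w q); [vec_ring|rewrite Ev, Ew; ring]).
    apply Rmult_integral in F1; apply Rmult_integral in F2.
    destruct q as [q1 q2]; simpl in *; f_equal; lra. }
  destruct Hpq as [Hp|Hq]; [|auto].
  apply Hp; rewrite <- E1, Eq; unfold dot; simpl; ring.
Qed.

(** Orthogonality to 1 will make the primitive of [H - k] periodic; orthogonality to the coordinates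
    of [gam] becomes, by parts, the constraint on members of [in_Lambda_star]. *)
Definition moment_corrector (c d K : R) : Prop :=
  forall H m, (forall t, continuous H t) -> (forall t, Rabs (H t) <= m) ->
  exists k : R -> R,
    (forall t, continuous k t) /\ (forall t, k (t + 2 * PI) = k t) /\
    (forall t, Rabs (k t) <= K * m) /\ (forall t, bump c d t = 0 -> k t = 0) /\
    RInt (fun t => H t - k t) 0 (2 * PI) = 0 /\
    forall e, RInt (fun t => (H t - k t) * dot (gam t) e) 0 (2 * PI) = 0.

Lemma moment_corrector_exists c d :
  0 <= c <= 2 * PI -> 0 < d <= PI -> exists K, 0 <= K /\ moment_corrector c d K.
Proof.
  intros Hc Hd; pose proof PI_RGT_0 as HPI.
  destruct gam_bounded as (M & HM & HMb).
  set (X := fun t => dot (gam t) (1, 0)); set (Y := fun t => dot (gam t) (0, 1)).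
  set (one := fun _ : R => 1).
  assert (U1 : enorm (1, 0) = 1) 
    by (transitivity (sqrt 1); [unfold enorm; f_equal; unfold dot; simpl; ring|apply sqrt_1]).
  assert (U2 : enorm (0, 1) = 1) 
    by (transitivity (sqrt 1); [unfold enorm; f_equal; unfold dot; simpl; ring|apply sqrt_1]).
  set (l := cons Y (cons X (cons one nil))).
  assert (Hl : forall P : (R -> R) -> Prop, P X -> P Y -> P one -> forall f, In f l -> P f).
  { intros P P1 P2 P3 f Hf; simpl in Hf; destruct Hf as [<-|[<-|[<-|[]]]]; assumption. }
  assert (Cl : forall f, In f l -> forall t, continuous f t).
  { apply (Hl (fun f => forall t, continuous f t)); [apply gam_dot_continuous|apply gam_dot_continuous|].
    intros t; apply continuous_const. }
  destruct (moment_correction (bump c d) (2 * PI) 2 (Rmax M 1) l) as (K & HK & Hcor).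
  - lra.
  - apply bump_continuous.
  - apply bump_bound.
  - exact Cl.
  - apply (Hl (fun f => forall t, Rabs (f t) <= Rmax M 1)); intros t.
    + eapply Rle_trans; [apply HMb, U1|apply Rmax_l].
    + eapply Rle_trans; [apply HMb, U2|apply Rmax_l].
    + unfold one; rewrite Rabs_R1; apply Rmax_r.
  (* In each of the three cases the difference to the span of the tail is an affine function of
     [gam] with a coefficient equal to 1. *)
  - simpl; repeat split.
    + intros v Hv.
      erewrite RInt_ext; [apply (bump_affine_square_pos c d 1 (0, 0) Hc Hd); left; lra|].
      intros t _; unfold one; rewrite Hv; unfold dot; simpl; ring.
    + intros v (p & v0 & H0 & E).
      erewrite RInt_ext; [apply (bump_affine_square_pos c d (- p) (1, 0) Hc Hd); right; intros F;
        injection F; lra|].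
      intros t _; rewrite E, H0; unfold X, one; simpl; ring.
    + intros v (p & v1 & (p1 & v0 & H0 & E1) & E).
      erewrite RInt_ext; [apply (bump_affine_square_pos c d (- p1) (- p, 1) Hc Hd); right; intros F;
        injection F; lra|].
      intros t _; rewrite E, E1, H0; unfold X, Y, one, dot; simpl; ring.
  - exists K; split; [exact HK|].
    intros H m CH Hm; destruct (Hcor H m CH Hm) as (v & Sv & Bv & Ov).
    pose proof (in_span_continuous l Cl v Sv) as Cv.
    pose proof (bump_continuous c d) as Cb.
    assert (Pv : forall t, v (t + 2 * PI) = v t).
    { apply (in_span_periodic (2 * PI) l); [|exact Sv].
      apply (Hl (fun f => forall t, f (t + 2 * PI) = f t)); intros t; unfold X, Y, one;
        rewrite ?gam_periodic; reflexivity. }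
    exists (fun t => bump c d t * v t); repeat split.
    + intros t; cont.
    + intros t; rewrite bump_periodic, Pv; reflexivity.
    + exact Bv.
    + intros t Ht; rewrite Ht; apply Rmult_0_l.
    + etransitivity; [|apply (Ov one); simpl; auto].
      apply RInt_ext; intros t _; unfold one; symmetry; apply Rmult_1_r.
    + intros e.
      set (g := fun t => H t - bump c d t * v t).
      assert (Cg : forall t, continuous g t) by (intros; unfold g; cont).
      assert (CX : forall t, continuous X t) by (apply Cl; simpl; auto).
      assert (CY : forall t, continuous Y t) by (apply Cl; simpl; auto).
      rewrite (RInt_ext _ (fun t => fst e * (g t * X t) + snd e * (g t * Y t)))
        by (intros t _; unfold X, Y, g, dot; simpl; ring).
      rewrite (RInt_lin2 (fun t => g t * X t) (fun t => g t * Y t)) by (intros; cont).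
      pose proof (Ov X ltac:(simpl; auto) : RInt (fun t => g t * X t) 0 (2 * PI) = 0) as OX.
      pose proof (Ov Y ltac:(simpl; auto) : RInt (fun t => g t * Y t) 0 (2 * PI) = 0) as OY.
      rewrite OX, OY, !Rmult_0_r; apply Rplus_0_l.
Qed.

Lemma moment_corrector_mono c d K K' :
  K <= K' -> moment_corrector c d K -> moment_corrector c d K'.
Proof.
  intros HK Hc H m CH Hm; destruct (Hc H m CH Hm) as (k & A1 & A2 & A3 & A4).
  exists k; refine (conj A1 (conj A2 (conj _ A4))).
  intros t; eapply Rle_trans; [apply A3|].
  apply Rmult_le_compat_r; [eapply Rle_trans; [apply Rabs_pos|apply (Hm 0)]|exact HK].
Qed.

(** A finite cover of the circle: the multiples of [d] in [[0, 2 * PI]] serve as centres, and the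
    largest of their constants works for all. *)
Lemma moment_corrector_uniform d :
  0 < d <= PI -> exists K, 0 <= K /\
  forall t, exists j c, Rabs (t + IZR j * (2 * PI) - c) <= d /\ moment_corrector c d K.
Proof.
  intros Hd; pose proof PI_RGT_0 as HPI.
  assert (Hfin : forall n : nat, exists K, 0 <= K /\
    forall i, (i <= n)%nat -> INR i * d <= 2 * PI -> moment_corrector (INR i * d) d K).
  { assert (Hone : forall i : nat, exists K, 0 <= K /\
      (INR i * d <= 2 * PI -> moment_corrector (INR i * d) d K)).
    { intros i; destruct (Rle_dec (INR i * d) (2 * PI)) as [Hi|Hi]; [|exists 0; split; [lra|tauto]].
      destruct (moment_corrector_exists (INR i * d) d) as (K & H1 & H2); [|exact Hd|exists K; auto].
      split; [apply Rmult_le_pos; [apply pos_INR|lra]|exact Hi]. }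
    induction n as [|n (K & HK & IH)].
    - destruct (Hone 0%nat) as (K & H1 & H2); exists K; split; [exact H1|].
      intros i Hi; replace i with 0%nat by lia; exact H2.
    - destruct (Hone (S n)) as (K' & H1 & H2); exists (Rmax K K').
      split; [eapply Rle_trans; [exact HK|apply Rmax_l]|].
      intros i Hi Hid; destruct (Nat.eq_dec i (S n)) as [->|Hn].
      + apply moment_corrector_mono with K'; [apply Rmax_r|auto].
      + apply moment_corrector_mono with K; [apply Rmax_l|apply IH; [lia|exact Hid]]. }
  destruct (nfloor_ex (2 * PI / d)) as [n [_ Hn]];
    [apply Rmult_le_pos; [lra|left; apply Rinv_0_lt_compat; lra]|].
  destruct (Hfin n) as (K & HK & Hc); exists K; split; [exact HK|].
  intros t; destruct (shift_into_period (2 * PI) 0 t ltac:(lra)) as [j Hj].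
  set (s := t + IZR j * (2 * PI)) in *.
  destruct (nfloor_ex (s / d)) as [i [Hi1 Hi2]];
    [apply Rmult_le_pos; [lra|left; apply Rinv_0_lt_compat; lra]|].
  assert (E : s = s / d * d) by (field; lra).
  assert (Hi3 : INR i * d <= s) by (rewrite E; apply Rmult_le_compat_r; lra).
  exists j, (INR i * d); fold s; split.
  - assert (s <= (INR i + 1) * d) by (rewrite E at 1; apply Rmult_le_compat_r; lra).
    apply Rabs_le; lra.
  - apply Hc; [|lra].
    assert (INR i < INR (S n)); [|apply INR_lt in H; lia].
    rewrite S_INR; apply Rle_lt_trans with (s / d); [exact Hi1|].
    apply Rle_lt_trans with (2 * PI / d); [|exact Hn].
    apply Rmult_le_compat_r; [left; apply Rinv_0_lt_compat|]; lra.
Qed.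

(** * The arc over a fixed chord *)

Section Chord.

Variables (tm tp : R).
Hypothesis Harc : tm < tp < tm + 2 * PI.

Let zp := gam tp.
Let zm := gam tm.
Let n := nu zp zm.
Let tau := chord_dir zp zm.
Let L := enorm (vsub zp zm).
Let h t := height zp zm (gam t).
Let dh t := - dot (dgam t) n.
Let x t := dot (gam t) tau.
Let dx t := dot (dgam t) tau.

Lemma arc_ends_neq : zp <> zm.
Proof.
  intros E; assert (tm = tp); [|lra].
  apply gam_injective; [lra|auto].
Qed.

Lemma height_derive t : is_derive h t (dh t).
Proof.
  unfold h, height, dh; evar_last.
  - apply (is_derive_minus (fun _ => dot zp n) (fun u => dot (gam u) n)).
    + apply is_derive_const.
    + apply gam_dot_derive.
  - unfold minus, plus, opp, zero; simpl; ring.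
Qed.

Lemma abscissa_derive t : is_derive x t (dx t).
Proof. apply gam_dot_derive. Qed.

Lemma height_deriv_continuous t : continuous dh t.
Proof. unfold dh; apply cont_opp, dgam_dot_continuous. Qed.

Lemma abscissa_deriv_continuous t : continuous dx t.
Proof. apply dgam_dot_continuous. Qed.

Lemma height_continuous t : continuous h t.
Proof. apply (continuous_of_derive _ _ height_derive). Qed.

Lemma height_tp : h tp = 0.
Proof. unfold h, height, zp; ring. Qed.

Lemma height_tm : h tm = 0.
Proof. apply (height_zm zp zm arc_ends_neq). Qed.

Lemma height_pos t : tm < t < tp -> 0 < h t.
Proof.
  intros Ht; pose proof (arc_right_of_chord tm t tp Ht ltac:(lra)) as H.
  pose proof (enorm_pos _ _ arc_ends_neq) as HL.
  unfold h; rewrite height_eq by apply arc_ends_neq.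
  apply Rmult_lt_0_compat; [apply Rinv_0_lt_compat, HL|exact H].
Qed.

Lemma height_nonneg t : tm <= t <= tp -> 0 <= h t.
Proof.
  intros Ht; destruct (Req_dec t tm) as [->|H1]; [rewrite height_tm; lra|].
  destruct (Req_dec t tp) as [->|H2]; [rewrite height_tp; lra|].
  left; apply height_pos; lra.
Qed.

(** Written in the frame, this says that the curve stays on one side of its tangent at [s]. *)
Lemma height_tangent s t : 0 <= (x s - x t) * - dh s + (h s - h t) * dx s.
Proof.
  replace ((x s - x t) * - dh s + (h s - h t) * dx s)
    with (det2 (gam s) (dgam s) - det2 (gam t) (dgam s)).
  - pose proof (gam_support s (gam t)) as H; rewrite gam_unit in H; lra.
  - rewrite !(frame_det2 zp zm arc_ends_neq).
    unfold x, h, dh, dx, height; fold n tau; ring.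
Qed.

(** The area under the arc is the integral of [h * dx]; unit speed gives [dx <= 1]. *)
Lemma triangle_le_height_integral t1 : tm <= t1 <= tp -> h t1 * L <= 2 * RInt h tm tp.
Proof.
  intros Ht.
  pose proof (triangle_le_area x h dx dh tm tp t1 abscissa_derive height_derive
    abscissa_deriv_continuous height_deriv_continuous height_tangent Ht height_tm height_tp) as H.
  replace (x tp - x tm) with L in H.
  - eapply Rle_trans; [exact H|].
    apply Rmult_le_compat_l; [lra|].
    pose proof height_continuous; pose proof abscissa_deriv_continuous.
    apply RInt_le_cont; [lra|intros; cont..|].
    intros t Hts; pose proof (height_nonneg t ltac:(lra)).
    assert (Hd : Rabs (dx t) <= 1) by (apply dgam_dot_bound, (frame_unit zp zm arc_ends_neq)).
    apply Rabs_le_between in Hd; nra.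
  - unfold x; fold zp zm; symmetry; apply (frame_length zp zm arc_ends_neq).
Qed.

Variables (r M : R).
Hypothesis Hr : 0 < r.
Hypothesis HrN : forall w, r * N w <= enorm w.
Hypothesis HM : forall e t, enorm e = 1 -> Rabs (dot (gam t) e) <= M.
(** [a] is also the height of the origin, so [Ha] keeps the origin off the side of the arc. *)
Let a := dot zp n.
Hypothesis Ha : a <= 0.

Lemma bound_pos : 0 < M.
Proof.
  pose proof (HM tau tp ltac:(apply (frame_unit zp zm arc_ends_neq))) as H1.
  pose proof (HM tau tm ltac:(apply (frame_unit zp zm arc_ends_neq))) as H2.
  pose proof (frame_length zp zm arc_ends_neq) as H3.
  pose proof (enorm_pos _ _ arc_ends_neq) as HL.
  apply Rabs_le_between in H1; apply Rabs_le_between in H2; fold tau in H3; fold zp in H1; fold zm in H2.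
  lra.
Qed.

(** * The apex of the arc and the size of [c1D] *)

Variable t0 : R.
Hypothesis Ht0 : tm <= t0 <= tp.
Hypothesis Hmax : forall t, tm <= t <= tp -> h t <= h t0.

Lemma height_max_pos : 0 < h t0.
Proof.
  apply Rlt_le_trans with (h ((tm + tp) / 2)); [apply height_pos|apply Hmax]; lra.
Qed.

Lemma apex_interior : tm < t0 < tp.
Proof.
  pose proof height_max_pos as H.
  split; apply Rnot_le_lt; intros Hle.
  - replace t0 with tm in H by lra; rewrite height_tm in H; lra.
  - replace t0 with tp in H by lra; rewrite height_tp in H; lra.
Qed.

(** At maximal height the tangent is parallel to the chord, so [dx t0] is 1 or -1; positivity of the
    determinant selects 1. *)
Lemma apex_tangent : dot (dgam t0) n = 0 /\ dx t0 = 1 /\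
  det2 (gam t0) (dgam t0) = h t0 - a.
Proof.
  assert (E : dot (dgam t0) n = 0).
  { pose proof (derive_0_at_max h dh tm tp t0 height_derive apex_interior Hmax) as H.
    unfold dh in H; lra. }
  destruct (gam_support_pos t0) as [Hb _].
  pose proof (frame_det2 zp zm arc_ends_neq (gam t0) (dgam t0)) as Hd.
  pose proof (frame_dot zp zm arc_ends_neq (dgam t0) (dgam t0)) as Hq.
  rewrite dgam_unit in Hq.
  fold n tau in Hd, Hq; fold (dx t0) in Hd, Hq; rewrite E in Hd, Hq.
  assert (Eh : h t0 = a - dot (gam t0) n) by reflexivity.
  pose proof height_max_pos as H0.
  assert (Hdx : (dx t0 - 1) * (dx t0 + 1) = 0) by lra.
  apply Rmult_integral in Hdx.
  assert (dx t0 = 1) by (destruct Hdx as [Hdx|Hdx]; [lra|nra]).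
  repeat split; nra.
Qed.

Lemma apex_depth_ge : r <= h t0 - a.
Proof.
  destruct apex_tangent as (_ & _ & <-); apply gam_support_ge; assumption.
Qed.

Lemma apex_depth_le : h t0 - a <= M.
Proof.
  pose proof (HM n t0 ltac:(apply (frame_unit zp zm arc_ends_neq))) as H.
  apply Rabs_le_between in H.
  assert (Eh : h t0 = a - dot (gam t0) n) by reflexivity; lra.
Qed.

(** On the chord line the supporting functional of the apex is constant, equal to
    [- a / (h t0 - a)], and it bounds [N] from below. *)
Lemma chord_norm_ge w : dot w n = a -> 1 - N w <= h t0 / r.
Proof.
  intros Hw; destruct apex_tangent as (E1 & E2 & E3).
  pose proof (gam_support t0 w) as H; rewrite E3 in H.
  rewrite (frame_det2 zp zm arc_ends_neq) in H.
  fold n tau in H; fold (dx t0) in H; rewrite E1, E2, Hw in H.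
  pose proof apex_depth_ge; pose proof height_max_pos.
  apply Rle_trans with (h t0 / (h t0 - a)).
  - apply Rmult_le_reg_r with (h t0 - a); [lra|].
    replace (h t0 / (h t0 - a) * (h t0 - a)) with (h t0) by (field; lra); lra.
  - apply Rmult_le_compat_l; [lra|]; apply Rinv_le_contravar; lra.
Qed.

Let s0 := - a / (h t0 - a).

Lemma apex_ratio : 0 <= s0 < 1 /\ h t0 / M <= 1 - s0.
Proof.
  pose proof apex_depth_ge; pose proof apex_depth_le; pose proof height_max_pos.
  assert (E : 1 - s0 = h t0 / (h t0 - a)) by (unfold s0; field; lra).
  assert (0 < h t0 / (h t0 - a)) by (apply Rdiv_lt_0_compat; lra).
  repeat split.
  - unfold s0; apply Rmult_le_pos; [lra|left; apply Rinv_0_lt_compat; lra].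
  - lra.
  - rewrite E; apply Rmult_le_compat_l; [lra|]; apply Rinv_le_contravar; lra.
Qed.

(* The point [s0 * gam t0] is where the segment from the origin to the apex
   crosses the chord; the disc of radius [r] around the origin, seen from the
   apex, covers a part of the chord line of length [2 (1 - s0) r]. *)
Lemma chord_point q : Rabs q <= r ->
  let w := vadd (vscal s0 (gam t0)) (vscal ((1 - s0) * q) tau) in
  dot w n = a /\ N w <= 1.
Proof.
  intros Hq w; destruct apex_ratio as [Hs _].
  destruct (frame_unit zp zm arc_ends_neq) as (Un & Ut & Unt); fold n tau in Un, Ut, Unt.
  split.
  - replace (dot w n) with (s0 * dot (gam t0) n + (1 - s0) * q * dot tau n)
      by (unfold w; vec_ring).
    rewrite Unt.
    assert (Eh : dot (gam t0) n = a - h t0) by (unfold h, height, a; fold n; ring).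
    rewrite Eh; unfold s0; pose proof apex_depth_ge; field; lra.
  - pose proof (HrN tau) as Ht; rewrite Ut in Ht.
    unfold w; eapply Rle_trans; [apply HN|].
    rewrite (norm_scal_nonneg N HN), gam_unit by lra.
    destruct HN as (_ & Hsc & _); rewrite Hsc, Rabs_mult, (Rabs_pos_eq (1 - s0)) by lra.
    pose proof (norm_nonneg N HN tau); pose proof (Rabs_pos q).
    assert (Rabs q * N tau <= 1) by nra.
    assert ((1 - s0) * Rabs q * N tau <= 1 - s0) by nra.
    lra.
Qed.

Lemma chord_point_inside w : dot w n = a -> N w <= 1 ->
  let u := (dot w tau - x tm) / L in w = seg zm zp u /\ 0 <= u <= 1.
Proof.
  intros Hw HNw u.
  assert (E : w = seg zm zp u) by (apply (chord_line zp zm arc_ends_neq); exact Hw).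
  split; [exact E|].
  apply (seg_inside N HN HS zm zp); try apply gam_unit.
  - intros F; apply arc_ends_neq; auto.
  - rewrite <- E; exact HNw.
Qed.

(** The points of [chord_point] with [q = r] and [q = - r] both lie on the chord, so
    [2 * (1 - s0) * r <= L], while [1 - s0] is at least [h t0 / M]. *)
Lemma apex_height_le_chord : 2 * r * h t0 <= M * L.
Proof.
  destruct apex_ratio as [Hs Hs'].
  pose proof bound_pos as HMp; pose proof (enorm_pos _ _ arc_ends_neq) as HL; fold L in HL.
  destruct (frame_unit zp zm arc_ends_neq) as (Un & Ut & Unt); fold n tau in Un, Ut, Unt.
  assert (Ett : dot tau tau = 1) by (rewrite <- enorm_sqr, Ut; ring).
  destruct (chord_point r) as [A1 A2]; [rewrite Rabs_pos_eq; lra|].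
  destruct (chord_point (- r)) as [B1 B2]; [rewrite Rabs_Ropp, Rabs_pos_eq; lra|].
  destruct (chord_point_inside _ A1 A2) as [_ A3].
  destruct (chord_point_inside _ B1 B2) as [_ B3].
  assert (E : forall q, dot (vadd (vscal s0 (gam t0)) (vscal ((1 - s0) * q) tau)) tau
              = s0 * dot (gam t0) tau + (1 - s0) * q).
  { intros q; transitivity (s0 * dot (gam t0) tau + (1 - s0) * q * dot tau tau);
      [vec_ring|rewrite Ett; ring]. }
  rewrite E in A3, B3.
  assert (K : 2 * (1 - s0) * r <= L).
  { apply Rmult_le_reg_r with (/ L); [apply Rinv_0_lt_compat, HL|].
    rewrite Rinv_r by lra.
    replace (2 * (1 - s0) * r * / L) with
      ((s0 * dot (gam t0) tau + (1 - s0) * r - x tm) / L -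
       (s0 * dot (gam t0) tau + (1 - s0) * - r - x tm) / L) by (field; lra).
    lra. }
  assert (h t0 <= (1 - s0) * M).
  { apply Rmult_le_reg_r with (/ M); [apply Rinv_0_lt_compat, HMp|].
    replace ((1 - s0) * M * / M) with (1 - s0) by (field; lra); exact Hs'. }
  nra.
Qed.

Lemma chord_norm_le u : 0 <= u <= 1 ->
  h t0 / M * (u * (1 - u)) <= 1 - N (seg zm zp u).
Proof.
  intros Hu; destruct apex_ratio as [Hs Hs'].
  destruct (chord_point 0) as [A1 A2]; [rewrite Rabs_R0; lra|].
  destruct (chord_point_inside _ A1 A2) as [A3 A4].
  replace (vadd (vscal s0 (gam t0)) (vscal ((1 - s0) * 0) tau)) with (vscal s0 (gam t0)) in * by vec_eq.
  set (v := (dot (vscal s0 (gam t0)) tau - x tm) / L) in *.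
  set (w := vscal s0 (gam t0)) in *.
  assert (Hw : N w = s0) by (unfold w; rewrite (norm_scal_nonneg N HN), gam_unit by lra; ring).
  assert (Hzm : N zm = 1) by apply gam_unit.
  assert (Hzp : N zp = 1) by apply gam_unit.
  (* By concavity [1 - N] lies above a tent of height [1 - s0] with its peak at [v]. Its sides have
     profiles [u / v] and [(1 - u) / (1 - v)], both at least [u * (1 - u)] wherever the peak is. *)
  assert (Htent : forall q, u * (1 - u) <= q -> (1 - s0) * q <= 1 - N (seg zm zp u) ->
            h t0 / M * (u * (1 - u)) <= 1 - N (seg zm zp u)).
  { intros q Hq1 Hq2; assert (0 <= u * (1 - u)) by nra.
    assert (h t0 / M * (u * (1 - u)) <= (1 - s0) * (u * (1 - u)))
      by (apply Rmult_le_compat_r; lra).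
    assert ((1 - s0) * (u * (1 - u)) <= (1 - s0) * q) by (apply Rmult_le_compat_l; lra).
    lra. }
  destruct (Rle_dec u v) as [Huv|Huv].
  - assert (Hv : v <> 0).
    { intros E; rewrite E in A3.
      replace (seg zm zp 0) with zm in A3 by (destruct zm; vec_eq).
      rewrite A3, Hzm in Hw; lra. }
    assert (Hi : u <= u / v <= 1).
    { split; apply Rmult_le_reg_r with v; try lra;
        replace (u / v * v) with u by (field; lra); nra. }
    apply Htent with (u / v); [nra|].
    pose proof (norm_seg N HN zm w (u / v) ltac:(lra)) as H.
    replace (seg zm w (u / v)) with (seg zm zp u) in H
      by (rewrite A3; vec_eq; field; lra).
    rewrite Hzm, Hw in H; lra.
  - assert (Hi : 1 - u <= (1 - u) / (1 - v) <= 1).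
    { split; apply Rmult_le_reg_r with (1 - v); try lra;
        replace ((1 - u) / (1 - v) * (1 - v)) with (1 - u) by (field; lra); nra. }
    apply Htent with ((1 - u) / (1 - v)); [nra|].
    pose proof (norm_seg N HN zp w ((1 - u) / (1 - v)) ltac:(lra)) as H.
    replace (seg zp w ((1 - u) / (1 - v))) with (seg zm zp u) in H
      by (rewrite A3; vec_eq; field; lra).
    rewrite Hzp, Hw in H; lra.
Qed.

Lemma seg_dot_normal u : dot (seg zm zp u) n = a.
Proof. apply (chord_dot_normal zp zm arc_ends_neq). Qed.

(** On the chord [N <= 1], so [1 - N ^ 2] lies between [1 - N] and its double; the 3 comes from the
    integral 1/6 of [u * (1 - u)]. *)
Lemma c1D_bounds :
  h t0 * L / (3 * M) <= c1D N zp zm <= 4 * (h t0 * L / r).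
Proof.
  pose proof bound_pos as HMp; pose proof (enorm_pos _ _ arc_ends_neq) as HL; fold L in HL.
  pose proof height_max_pos as H0.
  rewrite (c1D_unit_interval zp zm arc_ends_neq N HN); fold L.
  set (f := fun u => 1 - N (seg zm zp u) * N (seg zm zp u)).
  assert (Cf : forall u, continuous f u)
    by (intros u; unfold f; apply cont_minus; [apply continuous_const|];
        apply cont_mult; apply norm_seg_continuous, HN).
  assert (Hu : forall u, 0 <= u <= 1 ->
     1 - N (seg zm zp u) <= f u <= 2 * (1 - N (seg zm zp u))).
  { intros u Hu; pose proof (norm_seg N HN zm zp u Hu) as H.
    assert (Hzm : N zm = 1) by apply gam_unit.
    assert (Hzp : N zp = 1) by apply gam_unit.
    rewrite Hzm, Hzp in H.
    pose proof (norm_nonneg N HN (seg zm zp u)); unfold f; nra. }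
  assert (I1 : h t0 / M / 6 <= RInt f 0 1).
  { rewrite RInt_one_minus_pow2.
    apply RInt_le_cont; [lra| |exact Cf|].
    { generalize (h t0 / M); clear; intros; cont. }
    intros u Hu1; pose proof (Hu u ltac:(lra)); pose proof (chord_norm_le u ltac:(lra)); lra. }
  assert (I2 : RInt f 0 1 <= (1 - 0) * (2 * (h t0 / r))).
  { rewrite <- RInt_const_R; apply RInt_le_cont;
      [lra|exact Cf|intros; apply continuous_const|].
    intros u Hu1; pose proof (Hu u ltac:(lra)).
    pose proof (chord_norm_ge _ (seg_dot_normal u)); lra. }
  assert (Hp : 0 < h t0 / M / 6) by (apply Rdiv_lt_0_compat; [apply Rdiv_lt_0_compat|]; lra).
  rewrite Rabs_pos_eq by (apply Rmult_le_pos; lra).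
  split.
  - replace (h t0 * L / (3 * M)) with (2 * (L * (h t0 / M / 6))) by (field; lra); nra.
  - replace (4 * (h t0 * L / r)) with (2 * (L * (2 * (h t0 / r)))) by (field; lra); nra.
Qed.

(** * Arc length and the upper bound for the entropy integral *)

Lemma arc_le_chord : r * r * (tp - tm) <= (2 * M * r + 4 * PI * M) * L.
Proof.
  pose proof bound_pos as HMp; pose proof (enorm_pos _ _ arc_ends_neq) as HL; fold L in HL.
  pose proof height_max_pos as H0; pose proof PI_RGT_0 as HPI.
  pose proof apex_height_le_chord as HLh.
  assert (K : r * (tp - tm) <= 2 * h t0 * (tp - tm) + M * L).
  { pose proof (linear_growth_le x h dx dh a (2 * h t0) r tm tp abscissa_derive height_derive
      abscissa_deriv_continuous height_deriv_continuous ltac:(lra) height_tm height_tp) as Hle.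
    match type of Hle with ?P -> _ => assert (Hpt : P) end.
    (* The bounded quantity exceeds [det2 (gam t) (dgam t)] by [2 * (h t0 - h t * dx t)], which is
       nonnegative. *)
    { intros t Ht.
      apply Rle_trans with (det2 (gam t) (dgam t)); [apply gam_support_ge; assumption|].
      rewrite (frame_det2 zp zm arc_ends_neq); fold n tau; fold (dx t) (x t).
      assert (Eh : dot (gam t) n = a - h t) by (unfold h, height, a; fold n; ring).
      assert (Ed : dot (dgam t) n = - dh t) by (unfold dh; ring).
      rewrite Eh, Ed.
      pose proof (height_nonneg t ltac:(lra)); pose proof (Hmax t ltac:(lra)).
      assert (Hd : Rabs (dx t) <= 1) by (apply dgam_dot_bound, (frame_unit zp zm arc_ends_neq)).
      apply Rabs_le_between in Hd; nra. }
    specialize (Hle Hpt).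
    assert (EL : x tp - x tm = L) by apply (frame_length zp zm arc_ends_neq).
    assert (HaM : - a <= M).
    { pose proof (HM n tp ltac:(apply (frame_unit zp zm arc_ends_neq))) as H.
      apply Rabs_le_between in H; fold zp a in H; lra. }
    assert (- a * L <= M * L) by (apply Rmult_le_compat_r; lra).
    nra. }
  assert (HML : 0 < M * L) by (apply Rmult_lt_0_compat; lra).
  assert (HPML : 0 < PI * (M * L)) by (apply Rmult_lt_0_compat; lra).
  assert (HrML : 0 < r * (M * L)) by (apply Rmult_lt_0_compat; lra).
  (* For a flat arc the term [2 * h t0 * (tp - tm)] is absorbed on the left. For a high one the
     chord is bounded below and the arc is shorter than [2 * PI]. *)
  destruct (Rle_dec (h t0) (r / 4)) as [Hs|Hs].
  - assert (r * (tp - tm) <= 2 * (M * L)) by nra.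
    assert (r * (r * (tp - tm)) <= r * (2 * (M * L))) by (apply Rmult_le_compat_l; lra).
    lra.
  - assert (r * r <= 2 * (M * L)) by nra.
    assert (r * r * (tp - tm) <= 2 * (M * L) * (2 * PI)) by (apply Rmult_le_compat; nra).
    lra.
Qed.

Lemma entropy_le lam dlam : in_Lambda_star dgam lam dlam ->
  RInt (fun t => lam t * dot (dgam t) n) tm tp <= (tp - tm) * h t0.
Proof.
  intros (_ & Dl & Cdl & Bl & _).
  pose proof (continuous_of_derive _ _ Dl) as Cl.
  pose proof height_continuous as Ch; pose proof height_deriv_continuous as Cdh.
  pose proof (integration_by_parts lam h dlam dh tm tp Dl height_derive Cdl Cdh) as E.
  rewrite height_tp, height_tm in E.
  assert (F : (-1) * RInt (fun t => lam t * dh t) tm tp = RInt (fun t => lam t * dot (dgam t) n) tm tp).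
  { rewrite RInt_scal_cont by (intros; cont).
    apply RInt_ext; intros t _; unfold dh; simpl; ring. }
  rewrite <- F.
  assert (RInt (fun t => dlam t * h t) tm tp <= (tp - tm) * h t0); [|lra].
  rewrite <- RInt_const_R; apply RInt_le_cont;
    [lra|intros; cont|intros; apply continuous_const|].
  intros t Ht; pose proof (height_nonneg t ltac:(lra)); pose proof (Hmax t ltac:(lra)).
  pose proof (Bl t) as B; apply Rabs_le_between in B; nra.
Qed.

(** * The test function for the lower bound *)

Lemma height_periodic t : h (t + 2 * PI) = h t.
Proof. unfold h; rewrite gam_periodic; reflexivity. Qed.

(** The complementary arc lies to the right of the reversed chord. *)
Lemma height_outside t : tp <= t <= tm + 2 * PI -> h t <= 0.
Proof.
  intros Ht; destruct (Req_dec t tp) as [->|H1]; [rewrite height_tp; lra|].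
  destruct (Req_dec t (tm + 2 * PI)) as [->|H2]; [rewrite height_periodic, height_tm; lra|].
  pose proof (arc_right_of_chord tp t (tm + 2 * PI) ltac:(lra) ltac:(lra)) as H.
  rewrite gam_periodic in H; fold zp zm in H.
  pose proof (enorm_pos _ _ arc_ends_neq) as HL; fold L in HL.
  unfold h; rewrite (height_eq zp zm arc_ends_neq); fold L.
  replace (dot (vsub zm (gam t)) (rot (vsub zp zm)))
    with (- dot (vsub zp (gam t)) (rot (vsub zm zp))) by vec_ring.
  assert (0 < / L) by (apply Rinv_0_lt_compat, HL); nra.
Qed.

Lemma height_le_max t : h t <= h t0.
Proof.
  pose proof PI_RGT_0 as HPI.
  destruct (shift_into_period (2 * PI) tm t ltac:(lra)) as [k Hk].
  rewrite <- (periodic_IZR h (2 * PI) height_periodic k t).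
  destruct (Rle_dec (t + IZR k * (2 * PI)) tp) as [Hs|Hs]; [apply Hmax; lra|].
  apply Rle_trans with 0; [apply height_outside; lra|left; apply height_max_pos].
Qed.

(** The antipode of the apex has height [2 * a - h t0], at most [- r], and the height is
    1-Lipschitz. *)
Lemma height_neg_near_antipode : exists t1, forall t, Rabs (t - t1) < r -> h t < 0.
Proof.
  assert (Hant : N (vscal (-1) (gam t0)) = 1) by (rewrite (norm_vopp N HN); apply gam_unit).
  assert (Hsur : forall z : vec, N z = 1 -> exists t, gam t = z)
    by (destruct HG as (_ & _ & _ & _ & _ & H & _); exact H).
  destruct (Hsur _ Hant) as [t1 E]; exists t1; intros t Ht.
  pose proof (gam_dot_lipschitz n t1 t ltac:(apply (frame_unit zp zm arc_ends_neq))) as Hlip.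
  rewrite E in Hlip; pose proof apex_depth_ge.
  replace (dot (vscal (-1) (gam t0)) n) with (- dot (gam t0) n) in Hlip by vec_ring.
  assert (E0 : h t0 = a - dot (gam t0) n) by reflexivity.
  assert (Et : h t = a - dot (gam t) n) by reflexivity.
  apply Rabs_le_between in Hlip; lra.
Qed.

Variables (d K : R).
Hypothesis Hd : 0 < d <= PI.
Hypothesis Hdr : 2 * d <= r.
Hypothesis HK : 0 <= K.
Hypothesis Hcor :
  forall t, exists j c, Rabs (t + IZR j * (2 * PI) - c) <= d /\ moment_corrector c d K.

(* The density [dlam] is the positive part of the height above the chord, minus
   a moment correction supported where the height is negative. *)
Lemma entropy_ge : exists lam dlam, in_Lambda_star dgam lam dlam /\
  h t0 * L * (r * r) <=
  4 * (2 * M * r + 4 * PI * M) * (1 + K) * RInt (fun t => lam t * dot (dgam t) n) tm tp.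
Proof.
  pose proof height_max_pos as H0; pose proof PI_RGT_0 as HPI.
  pose proof height_continuous as Ch; pose proof height_deriv_continuous as Cdh.
  pose proof (enorm_pos _ _ arc_ends_neq) as HL; fold L in HL.
  destruct height_neg_near_antipode as [t1 Hneg].
  destruct (Hcor t1) as (j & c & Hc & Hmc).
  set (hp := fun t => Rmax 0 (h t)).
  assert (Chp : forall t, continuous hp t) by (intros; unfold hp; cont).
  assert (Bhp : forall t, Rabs (hp t) <= h t0).
  { intros t; rewrite Rabs_pos_eq by apply Rmax_l.
    apply Rmax_lub; [lra|apply height_le_max]. }
  destruct (Hmc hp (h t0) Chp Bhp) as (k & Ck & Pk & Bk & Sk & Ik & Ike).
  (* The support of [k] is within [2 * d <= r] of [t1] modulo the period, where the height is
     negative. *)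
  assert (Hk : forall t, 0 < h t -> k t = 0).
  { intros t Ht; apply Sk.
    destruct (Req_dec (bump c d t) 0) as [E|E]; [exact E|exfalso].
    destruct (bump_support c d t Hd E) as [i Hi].
    assert (Hn : h (t + IZR (i - j) * (2 * PI)) < 0).
    { apply Hneg; rewrite minus_IZR; apply Rabs_le_between in Hc; apply Rabs_def2 in Hi.
      apply Rabs_def1; lra. }
    rewrite (periodic_IZR h (2 * PI) height_periodic) in Hn; lra. }
  (* Normalizes the density: [hp - k] is bounded by [(1 + K) * h t0]. *)
  set (q := / ((1 + K) * h t0)).
  assert (Hq : 0 < q) by (apply Rinv_0_lt_compat, Rmult_lt_0_compat; lra).
  set (mu := fun t => q * (hp t - k t)).
  assert (Cmu : forall t, continuous mu t) by (intros; unfold mu; cont).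
  assert (Pmu : forall t, mu (t + 2 * PI) = mu t)
    by (intros t; unfold mu, hp; rewrite height_periodic, Pk; reflexivity).
  assert (Imu : RInt mu 0 (2 * PI) = 0).
  { unfold mu; rewrite <- (RInt_scal_cont (fun t => hp t - k t)) by (intros; cont).
    rewrite Ik; apply Rmult_0_r. }
  set (lam := fun t => RInt mu 0 t).
  assert (Dlam : forall t, is_derive lam t (mu t))
    by (intros t; apply is_derive_primitive, Cmu).
  pose proof (continuous_of_derive _ _ Dlam) as Clam.
  assert (Imom : forall e, RInt (fun t => lam t * dot (dgam t) e) 0 (2 * PI) = 0).
  { intros e.
    pose proof (integration_by_parts lam (fun t => dot (gam t) e) mu (fun t => dot (dgam t) e)
      0 (2 * PI) Dlam (gam_dot_derive e) Cmu (dgam_dot_continuous e)) as E.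
    assert (E0 : lam 0 = 0) by (unfold lam; rewrite RInt_point; reflexivity).
    assert (E1 : lam (2 * PI) = 0) by exact Imu.
    assert (E2 : RInt (fun t => mu t * dot (gam t) e) 0 (2 * PI) = 0).
    { pose proof (gam_dot_continuous e) as Cg.
      rewrite (RInt_ext _ (fun t => q * ((hp t - k t) * dot (gam t) e)))
        by (intros t _; unfold mu; simpl; ring).
      rewrite <- (RInt_scal_cont (fun t => (hp t - k t) * dot (gam t) e)) by (intros; cont).
      rewrite Ike; apply Rmult_0_r. }
    rewrite E0, E1, E2 in E; lra. }
  exists lam, mu; split.
  - refine (conj _ (conj Dlam (conj Cmu (conj _ (conj _ _))))).
    + intros t; unfold lam; rewrite RInt_period_shift by assumption.
      rewrite Imu; apply Rplus_0_r.
    + intros t; unfold mu; rewrite Rabs_mult, (Rabs_pos_eq q) by lra.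
      apply Rle_trans with (q * ((1 + K) * h t0)).
      * apply Rmult_le_compat_l; [lra|].
        unfold Rminus; eapply Rle_trans; [apply Rabs_triang|].
        rewrite Rabs_Ropp; pose proof (Bhp t); pose proof (Bk t); lra.
      * right; unfold q; field; split; lra.
    + etransitivity; [|apply (Imom (1, 0))].
      apply RInt_ext; intros t _; unfold dot; simpl; ring.
    + etransitivity; [|apply (Imom (0, 1))].
      apply RInt_ext; intros t _; unfold dot; simpl; ring.
  - pose proof (integration_by_parts lam h mu dh tm tp Dlam height_derive Cmu Cdh) as E.
    rewrite height_tp, height_tm in E.
    assert (F : (-1) * RInt (fun t => lam t * dh t) tm tp
                = RInt (fun t => lam t * dot (dgam t) n) tm tp).
    { rewrite RInt_scal_cont by (intros; cont).
      apply RInt_ext; intros t _; unfold dh; simpl; ring. }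
    rewrite <- F.
    assert (G : RInt (fun t => mu t * h t) tm tp = q * RInt (fun t => h t * h t) tm tp).
    { rewrite RInt_scal_cont by (intros; cont).
      apply RInt_ext; intros t Ht.
      rewrite Rmin_left, Rmax_right in Ht by lra.
      pose proof (height_pos t Ht); unfold mu, hp.
      rewrite Rmax_right, Hk by lra; simpl; ring. }
    set (ell := tp - tm); assert (Hell : 0 < ell) by (unfold ell; lra).
    (* [p] is the lower bound for the mean of [h] given by the triangle. Integrating
       [(h - p) ^ 2 >= 0] replaces the Cauchy-Schwarz inequality. *)
    set (p := h t0 * L / (2 * ell)).
    assert (Hp : 0 < p) by (apply Rdiv_lt_0_compat; [apply Rmult_lt_0_compat|]; lra).
    assert (Sq : 2 * p * RInt h tm tp - ell * (p * p) <= RInt (fun t => h t * h t) tm tp).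
    { replace (2 * p * RInt h tm tp - ell * (p * p))
        with (2 * p * RInt h tm tp + (-1) * RInt (fun _ => p * p) tm tp)
        by (rewrite RInt_const_R; unfold ell; ring).
      rewrite <- (RInt_lin2 h (fun _ => p * p)) by (intros; cont).
      apply RInt_le_cont; [lra|intros; cont|intros; cont|].
      intros t _; pose proof (Rle_0_sqr (h t - p)); unfold Rsqr in *; lra. }
    pose proof (triangle_le_height_integral t0 Ht0) as T.
    set (A := 2 * M * r + 4 * PI * M).
    pose proof arc_le_chord as Harcl; fold ell A in Harcl.
    set (I := RInt (fun t => h t * h t) tm tp) in *.
    assert (HI : h t0 * L * (h t0 * L) <= 4 * ell * I).
    { assert (p * (h t0 * L) <= p * (2 * RInt h tm tp)) by (apply Rmult_le_compat_l; lra).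
      assert (E1 : 2 * ell * p = h t0 * L) by (unfold p; field; lra).
      assert (E2 : p * (h t0 * L) - ell * (p * p) <= I) by lra.
      assert (4 * ell * (p * (h t0 * L) - ell * (p * p)) <= 4 * ell * I)
        by (apply Rmult_le_compat_l; lra).
      replace (4 * ell * (p * (h t0 * L) - ell * (p * p)))
        with (2 * (2 * ell * p) * (h t0 * L) - (2 * ell * p) * (2 * ell * p)) in H1 by ring.
      rewrite E1 in H1; lra. }
    assert (HIpos : 0 <= I) by (apply RInt_ge_0; [lra|apply ex_RInt_cont; intros; cont|];
      intros t _; apply Rle_0_sqr).
    assert (E3 : (-1) * RInt (fun t => lam t * dh t) tm tp = q * I) by lra.
    rewrite E3.
    (* With this factor the left side becomes the square bounded in [HI]; on the right
       [q * h t0 = / (1 + K)] cancels, and [Harcl] replaces [r * r * ell] by [A * L]. *)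
    apply Rmult_le_reg_r with (h t0 * L); [apply Rmult_lt_0_compat; lra|].
    apply Rle_trans with (4 * (r * r * ell) * I).
    + replace (h t0 * L * (r * r) * (h t0 * L)) with (r * r * (h t0 * L * (h t0 * L))) by ring.
      replace (4 * (r * r * ell) * I) with (r * r * (4 * ell * I)) by ring.
      apply Rmult_le_compat_l; [apply Rle_0_sqr|exact HI].
    + replace (4 * A * (1 + K) * (q * I) * (h t0 * L)) with (4 * (A * L) * I)
        by (unfold q; field; split; lra).
      apply Rmult_le_compat_r; [exact HIpos|lra].
Qed.

End Chord.

(** * Comparison of the two costs *)

Lemma arc_comparison tm tp r M d K :
  tm < tp < tm + 2 * PI ->
  0 < r -> (forall w, r * N w <= enorm w) ->
  (forall e t, enorm e = 1 -> Rabs (dot (gam t) e) <= M) ->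
  dot (gam tp) (nu (gam tp) (gam tm)) <= 0 ->
  0 < d <= PI -> 2 * d <= r -> 0 <= K ->
  (forall t, exists j c, Rabs (t + IZR j * (2 * PI) - c) <= d /\ moment_corrector c d K) ->
  let A := (2 * M * r + 4 * PI * M) / (r * r) in
  let D := c1D N (gam tp) (gam tm) in
  let n := nu (gam tp) (gam tm) in
  (forall lam dlam, in_Lambda_star dgam lam dlam ->
     RInt (fun t => lam t * dot (dgam t) n) tm tp <= 3 * M * A * D) /\
  exists lam dlam, in_Lambda_star dgam lam dlam /\
     D <= 16 * A * (1 + K) / r * RInt (fun t => lam t * dot (dgam t) n) tm tp.
Proof.
  intros Harc Hr HrN HM Ha Hd Hdr HK Hcor A D n; pose proof PI_RGT_0 as HPI.
  set (zp := gam tp); set (zm := gam tm); set (L := enorm (vsub zp zm)).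
  set (h := fun t => height zp zm (gam t)).
  destruct (continuous_attains_max h tm tp ltac:(lra)) as (t0 & Ht0 & Hmax).
  { intros t; apply height_continuous. }
  assert (HMp : 0 < M) by exact (bound_pos tm tp Harc M HM).
  assert (HL : 0 < L) by exact (enorm_pos _ _ (arc_ends_neq tm tp Harc)).
  assert (H0 : 0 < h t0) by exact (height_max_pos tm tp Harc t0 Hmax).
  assert (HD : h t0 * L / (3 * M) <= D <= 4 * (h t0 * L / r))
    by exact (c1D_bounds tm tp Harc r M Hr HrN HM Ha t0 Ht0 Hmax).
  assert (HA : r * r * (tp - tm) <= (2 * M * r + 4 * PI * M) * L)
    by exact (arc_le_chord tm tp Harc r M Hr HrN HM Ha t0 Ht0 Hmax).
  assert (EA : 2 * M * r + 4 * PI * M = r * r * A) by (unfold A; field; lra).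
  rewrite EA in HA.
  assert (Hrr : 0 < r * r) by (apply Rmult_lt_0_compat; lra).
  assert (HAp : 0 < A).
  { apply Rdiv_lt_0_compat; [|exact Hrr].
    pose proof (Rmult_lt_0_compat M r HMp Hr); pose proof (Rmult_lt_0_compat PI M HPI HMp); lra. }
  (* Each estimate passes through [h t0 * L]: the upper bound for one cost meets the lower bound for
     the other. *)
  split.
  - intros lam dlam Hl.
    apply Rle_trans with ((tp - tm) * h t0).
    { exact (entropy_le tm tp Harc t0 Hmax lam dlam Hl). }
    assert (tp - tm <= A * L) by (apply Rmult_le_reg_l with (r * r); lra).
    apply Rle_trans with (A * L * h t0); [apply Rmult_le_compat_r; lra|].
    replace (A * L * h t0) with (3 * M * A * (h t0 * L / (3 * M))) by (field; lra).
    apply Rmult_le_compat_l; [|apply HD].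
    pose proof (Rmult_lt_0_compat M A HMp HAp); lra.
  - destruct (entropy_ge tm tp Harc r M Hr HrN HM Ha t0 Ht0 Hmax d K Hd Hdr HK Hcor)
      as (lam & dlam & Hl & HI).
    exists lam, dlam; split; [exact Hl|].
    eapply Rle_trans; [apply HD|].
    apply Rmult_le_reg_l with (r * r * r / 4); [apply Rdiv_lt_0_compat; nra|].
    rewrite EA in HI.
    replace (r * r * r / 4 * (4 * (h t0 * L / r))) with (h t0 * L * (r * r)) by (field; lra).
    eapply Rle_trans; [exact HI|].
    right; unfold n; field; lra.
Qed.

(** The integrand is periodic and, by the two moment conditions, has zero mean. Hence the entropy
    integral does not depend on the chosen lifts of the end points. *)
Lemma RInt_entropy_shift lam dlam e s t k : in_Lambda_star dgam lam dlam ->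
  RInt (fun u => lam u * dot (dgam u) e) s (t + IZR k * (2 * PI)) =
  RInt (fun u => lam u * dot (dgam u) e) s t.
Proof.
  intros (Pl & Dl & _ & _ & I1 & I2).
  pose proof (continuous_of_derive _ _ Dl) as Cl.
  set (f := fun u => lam u * dot (dgam u) e).
  assert (Cf : forall u, continuous f u)
    by (intros u; apply cont_mult; [apply Cl|apply dgam_dot_continuous]).
  assert (C1 : forall u, continuous (fun u => lam u * fst (dgam u)) u).
  { intros u; apply cont_mult; [apply Cl|].
    apply (continuous_ext (fun u => dot (dgam u) (1, 0))); [|apply dgam_dot_continuous].
    intros v; unfold dot; simpl; ring. }
  assert (C2 : forall u, continuous (fun u => lam u * snd (dgam u)) u).
  { intros u; apply cont_mult; [apply Cl|].
    apply (continuous_ext (fun u => dot (dgam u) (0, 1))); [|apply dgam_dot_continuous].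
    intros v; unfold dot; simpl; ring. }
  assert (I0 : RInt f 0 (2 * PI) = 0).
  { rewrite (RInt_ext f (fun u => fst e * (lam u * fst (dgam u)) + snd e * (lam u * snd (dgam u))))
      by (intros u _; unfold f, dot; simpl; ring).
    rewrite (RInt_lin2 (fun u => lam u * fst (dgam u)) (fun u => lam u * snd (dgam u)) _ _ _ _ C1 C2).
    rewrite I1, I2, !Rmult_0_r; apply Rplus_0_l. }
  assert (P : forall u, RInt f 0 (u + 2 * PI) = RInt f 0 u).
  { intros u; rewrite RInt_period_shift; [rewrite I0; apply Rplus_0_r|exact Cf|].
    intros v; unfold f; rewrite Pl, dgam_dot_periodic; reflexivity. }
  pose proof (periodic_IZR (fun u => RInt f 0 u) (2 * PI) P k t) as E; simpl in E.
  rewrite <- (RInt_Chasles_cont f s 0 (t + IZR k * (2 * PI)) Cf), E.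
  apply RInt_Chasles_cont, Cf.
Qed.

Lemma comparison_nonpos : exists C0, 0 < C0 /\
  forall zp zm, N zp = 1 -> N zm = 1 -> zp <> zm -> dot zp (nu zp zm) <= 0 ->
    Rbar_le (Finite (/ C0 * c1D N zp zm)) (cENT gam dgam zp zm) /\
    Rbar_le (cENT gam dgam zp zm) (Finite (C0 * c1D N zp zm)).
Proof.
  pose proof PI_RGT_0 as HPI.
  destruct (norm_le_enorm N HN) as (r & Hr & HrN).
  destruct gam_bounded as (M & HMp & HM).
  (* [d <= PI] is required by the bumps, [2 * d <= r] by the room around the antipode. *)
  set (d := Rmin (r / 2) PI).
  assert (Hd : 0 < d <= PI) by (unfold d; split; [apply Rmin_glb_lt; lra|apply Rmin_r]).
  assert (Hdr : 2 * d <= r) by (unfold d; pose proof (Rmin_l (r / 2) PI); lra).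
  destruct (moment_corrector_uniform d Hd) as (K & HK & Hcor).
  set (A := (2 * M * r + 4 * PI * M) / (r * r)).
  assert (HA : 0 < A).
  { apply Rdiv_lt_0_compat; [|apply Rmult_lt_0_compat; lra].
    pose proof (Rmult_lt_0_compat M r HMp Hr); pose proof (Rmult_lt_0_compat PI M HPI HMp); lra. }
  set (B1 := 3 * M * A); set (B2 := 16 * A * (1 + K) / r).
  assert (HB1 : 0 < B1) by (unfold B1; pose proof (Rmult_lt_0_compat M A HMp HA); lra).
  assert (HB2 : 0 < B2) by (apply Rdiv_lt_0_compat; [apply Rmult_lt_0_compat|]; lra).
  exists (B1 + B2); split; [lra|].
  intros zp zm Hzp Hzm Hneq Ha.
  assert (Hsur : forall z : vec, N z = 1 -> exists t, gam t = z)
    by (destruct HG as (_ & _ & _ & _ & _ & H & _); exact H).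
  (* The left inequality is strict because [zp] and [zm] differ. *)
  assert (Hlift : forall tm tp, gam tm = zm -> gam tp = zp -> exists k,
    tm < tp + IZR k * (2 * PI) < tm + 2 * PI /\ gam (tp + IZR k * (2 * PI)) = zp).
  { intros tm tp Etm Etp.
    destruct (shift_into_period (2 * PI) tm tp ltac:(lra)) as [k [[Hk|Hk] Hk']]; exists k;
      rewrite (periodic_IZR gam (2 * PI) gam_periodic k tp); [auto|].
    exfalso; apply Hneq; rewrite <- Etm, Hk, <- Etp; symmetry.
    apply (periodic_IZR gam (2 * PI) gam_periodic k tp). }
  assert (Hcmp : forall tm tp, gam tm = zm -> gam tp = zp -> tm < tp < tm + 2 * PI -> _)
    by (intros tm tp Etm Etp Harc; rewrite <- Etp, <- Etm in Ha;
        pose proof (arc_comparison tm tp r M d K Harc Hr HrN HM Ha Hd Hdr HK Hcor) as H;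
        cbv zeta in H; rewrite Etp, Etm in H; exact H).
  destruct (Hsur zm Hzm) as [tm Etm]; destruct (Hsur zp Hzp) as [tq Etq].
  destruct (Hlift tm tq Etm Etq) as (k0 & Harc & Etp).
  set (tp := tq + IZR k0 * (2 * PI)) in *.
  destruct (Hcmp tm tp Etm Etp Harc) as [_ (lam & dlam & Hl & Hlow)].
  set (D := c1D N zp zm) in *.
  assert (HD : 0 <= D) by (apply Rmult_le_pos; [lra|apply Rabs_pos]).
  destruct (Lub_Rbar_correct (fun v => exists (lam dlam : R -> R) (thp thm : R),
    in_Lambda_star dgam lam dlam /\ gam thp = zp /\ gam thm = zm /\
    v = RInt (fun t => lam t * dot (dgam t) (nu zp zm)) thm thp)) as [Hub Hleast].
  split.
  - eapply Rbar_le_trans; [|apply Hub; exists lam, dlam, tp, tm; auto].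
    simpl; fold A B2 in Hlow.
    set (I := RInt (fun t => lam t * dot (dgam t) (nu zp zm)) tm tp) in *.
    assert (0 <= I) by nra.
    apply Rmult_le_reg_l with (B1 + B2); [lra|].
    rewrite <- Rmult_assoc, Rinv_r, Rmult_1_l by lra; nra.
  (* A competitor comes with arbitrary parameters; shifting [thp] by whole periods makes the arc
     admissible without changing the value. *)
  - apply Hleast; intros v (lam' & dlam' & thp & thm & Hl' & Ep & Em & ->); simpl.
    destruct (Hlift thm thp Em Ep) as (k & Harc' & Ep').
    destruct (Hcmp thm _ Em Ep' Harc') as [Hup _].
    specialize (Hup lam' dlam' Hl').
    rewrite (RInt_entropy_shift lam' dlam') in Hup by exact Hl'.
    fold A B1 in Hup; nra.
Qed.

End Curve.

(** * Exchange of the end points and conclusion *)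

Lemma nu_swap zp zm : nu zm zp = vscal (-1) (nu zp zm).
Proof.
  unfold nu; replace (enorm (vsub zm zp)) with (enorm (vsub zp zm)).
  - vec_eq.
  - unfold enorm; f_equal; vec_ring.
Qed.

Lemma c1D_swap (N : vec -> R) (HN : is_norm N) zp zm : zp <> zm -> c1D N zm zp = c1D N zp zm.
Proof.
  intros Hneq.
  rewrite (c1D_unit_interval zp zm Hneq N HN), (c1D_unit_interval zm zp (not_eq_sym Hneq) N HN).
  replace (enorm (vsub zm zp)) with (enorm (vsub zp zm)) by (unfold enorm; f_equal; vec_ring).
  f_equal; f_equal; f_equal.
  set (g := fun u => 1 - N (seg zm zp u) * N (seg zm zp u)).
  assert (Cg : forall u, continuous g u).
  { intros u; apply cont_minus; [apply continuous_const|].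
    apply cont_mult; apply norm_seg_continuous, HN. }
  (* The substitution [u] to [1 - u] reverses the chord. *)
  pose proof (RInt_comp_lin g (-1) 1 0 1 ltac:(apply ex_RInt_cont, Cg)) as E.
  replace (-1 * 0 + 1) with 1 in E by ring; replace (-1 * 1 + 1) with 0 in E by ring.
  pose proof (RInt_Chasles_cont g 0 1 0 Cg) as F.
  rewrite <- E, RInt_point in F.
  change (RInt g 0 1 + RInt (fun y => -1 * g (-1 * y + 1)) 0 1 = 0) in F.
  assert (Cg' : forall u, continuous (fun u => 1 - N (seg zp zm u) * N (seg zp zm u)) u).
  { intros u; apply cont_minus; [apply continuous_const|].
    apply cont_mult; apply norm_seg_continuous, HN. }
  assert (G : RInt (fun y => -1 * g (-1 * y + 1)) 0 1 =
              (-1) * RInt (fun u => 1 - N (seg zp zm u) * N (seg zp zm u)) 0 1).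
  { rewrite RInt_scal_cont by exact Cg'.
    apply RInt_ext; intros u _; unfold g.
    replace (seg zm zp (-1 * u + 1)) with (seg zp zm u) by vec_eq; reflexivity. }
  apply Rle_antisym; lra.
Qed.

(** Both the normal and the orientation of the interval of integration change sign, so the two sets
    of values coincide. *)
Lemma cENT_swap N gam dgam (HG : arclength_param N gam dgam) zp zm :
  cENT gam dgam zm zp = cENT gam dgam zp zm.
Proof.
  assert (H : forall zp zm v, (exists (lam dlam : R -> R) (thp thm : R),
      in_Lambda_star dgam lam dlam /\ gam thp = zp /\ gam thm = zm /\
      v = RInt (fun t => lam t * dot (dgam t) (nu zp zm)) thm thp) ->
    exists (lam dlam : R -> R) (thp thm : R),
      in_Lambda_star dgam lam dlam /\ gam thp = zm /\ gam thm = zp /\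
      v = RInt (fun t => lam t * dot (dgam t) (nu zm zp)) thm thp).
  { intros p m v (lam & dlam & thp & thm & Hl & Ep & Em & ->).
    exists lam, dlam, thm, thp; refine (conj Hl (conj Em (conj Ep _))).
    pose proof (continuous_of_derive _ _ (proj1 (proj2 Hl))) as Cl.
    pose proof (dgam_dot_continuous N gam dgam HG (nu p m)) as Cd.
    rewrite (RInt_ext (fun t => lam t * dot (dgam t) (nu m p))
               (fun t => (-1) * (lam t * dot (dgam t) (nu p m))))
      by (intros t _; rewrite nu_swap; vec_ring).
    rewrite <- (RInt_scal_cont (fun t => lam t * dot (dgam t) (nu p m))) by (intros; cont).
    pose proof (RInt_Chasles_cont (fun t => lam t * dot (dgam t) (nu p m)) thm thp thm
                  ltac:(intros; cont)) as E.
    rewrite RInt_point in E; unfold zero in E; simpl in E; lra. }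
  apply Lub_Rbar_eqset; intros v; split; apply H.
Qed.

Theorem theorem1p11 (N : vec -> R) (gam dgam : R -> vec) :
  is_norm N -> strictly_convex N -> C1_away_from_0 N ->
  arclength_param N gam dgam ->
  exists C0 : R, 0 < C0 /\
    forall zp zm : vec, N zp = 1 -> N zm = 1 -> zp <> zm ->
      Rbar_le (Finite (/ C0 * c1D N zp zm)) (cENT gam dgam zp zm) /\
      Rbar_le (cENT gam dgam zp zm) (Finite (C0 * c1D N zp zm)).
Proof.
  intros HN HS HC HG.
  destruct (comparison_nonpos N gam dgam HN HS HC HG) as (C0 & HC0 & H).
  exists C0; split; [exact HC0|]; intros zp zm Hp Hm Hneq.
  destruct (Rle_dec (dot zp (nu zp zm)) 0) as [Ha|Ha]; [auto|].
  rewrite <- (c1D_swap N HN zp zm Hneq), <- (cENT_swap N gam dgam HG zp zm).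
  apply H; auto.
  (* Both end points have the same normal coordinate, and the exchange reverses the normal, so
     [a > 0] turns into [- a < 0]. *)
  pose proof (height_zm zp zm Hneq) as E; unfold height in E.
  rewrite nu_swap.
  replace (dot zm (vscal (-1) (nu zp zm))) with (- dot zm (nu zp zm)) by vec_ring; lra.
Qed.
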